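(* Let $X$ and $Y$ be proper CAT(0) spaces with basepoints $x_0\in X$, $y_0\in Y$, and assume: (i) $h=(h_1,h_2):X\times Y\to X\times Y$ is a factor-preserving homeomorphism (that is, $h(x,y)=(h_1(x),h_2(y))$); (ii) $h_1:X\to X$ is an isometry; (iii) $h_2:Y\to Y$ is a homeomorphism and a quasi-isometry which extends to a homeomorphism of $\overline{Y}=Y\cup\partial_\infty Y$; (iv) $Y$ is radially compressible toward $y_0$. Let $\psi:\mathbb{R}^+\to\mathbb{R}^+$ be a proper function, let $h_\psi:Y\to Y$ be a compressing homeomorphism for $\psi$ which is the radial homeomorphism based on a homeomorphism $\widehat h_\psi:\mathbb{R}^+\to\mathbb{R}^+$ that is linearly controlled, and let $H_\psi=(\mathrm{id}_X,h_\psi):X\times Y\to X\times Y$. Then the compressed homeomorphism $H_\psi h H_\psi^{-1}$ of $X\times Y$ extends to the boundary $\partial_\infty(X\times Y)=\partial_\infty X\ast\partial_\infty Y$, and the induced homeomorphism of $\partial_\infty X\ast\partial_\infty Y$ is the join of the homeomorphisms of $\partial_\infty X$ and $\partial_\infty Y$ induced by $h_1$ and $h_2$.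
   Context: $\mathbb{R}^+=[0,\infty)$. $X\times Y$ has the $\ell_2$-product metric; for proper CAT(0) spaces, $\partial_\infty(X\times Y)$ is the topological join $\partial_\infty X\ast\partial_\infty Y$ (join lines parametrized by slope in $[0,\infty]$), and $\overline{W}=W\cup\partial_\infty W$ carries the cone topology. ''Extends to the boundary'' means extends to a homeomorphism of $\overline{X\times Y}$. A function is proper if preimages of compact sets are compact; $\phi:\mathbb{R}^+\to\mathbb{R}^+$ is sublinear if $\phi(x)/x\to0$ as $x\to\infty$. A homeomorphism $h_\psi:Y\to Y$ is a compressing homeomorphism for a proper $\psi:\mathbb{R}^+\to\mathbb{R}^+$ if there is a sublinear $\phi:\mathbb{R}^+\to\mathbb{R}^+$ such that, for every $R$ and every compact $K\subset Y$ with $\operatorname{diam}(K)<\psi(R)$, $\operatorname{diam}(h_\psi(K))<\phi(R)$. $Y$ is radially compressible toward $y_0$ if $Y$ admits an open cone structure with cone point $y_0$ (a homeomorphism $Y\approx L\times[0,\infty)/L\times\{0\}$, $L$ compact) whose cone lines are geodesic rays emanating from $y_0$, parametrized by distance from $y_0$; in this case, for every proper $\psi$ there is a homeomorphism $\widehat h_\psi:\mathbb{R}^+\to\mathbb{R}^+$ for which the associated radial homeomorphism is a compressing homeomorphism for $\psi$. The radial homeomorphism of $Y$ based on a homeomorphism $\widehat h:\mathbb{R}^+\to\mathbb{R}^+$ is the map $Y\to Y$ acting as $\widehat h$ on each cone line. $\widehat h_\psi$ is linearly controlled if $\lim_{t\to\infty}\frac{\widehat h_\psi\, g\,\widehat h_\psi^{-1}(t)}{t}=1$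 for all linear maps $g:\mathbb{R}^+\to\mathbb{R}^+$, $g(t)=at$ with $a>0$. *)

(* Defs.v *)
From HB Require Import structures.
From mathcomp Require Import all_boot all_order all_algebra generic_quotient.
From mathcomp Require Import all_classical all_reals all_analysis.
From mathcomp Require Import ring lra.

Set Implicit Arguments.
Unset Strict Implicit.
Unset Printing Implicit Defensive.

Import Order.TTheory GRing.Theory Num.Theory.
Import numFieldNormedType.Exports.

Local Open Scope classical_set_scope.
Local Open Scope ring_scope.
Local Open Scope quotient_scope.

(** * Homeomorphisms *)

Record homeo (T U : topologicalType) := Homeo {
  homeo_fun :> T -> U;
  homeo_inv : U -> T;
  homeoK : cancel homeo_fun homeo_inv;
  homeo_invK : cancel homeo_inv homeo_fun;
  homeo_continuous : continuous homeo_fun;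
  homeo_inv_continuous : continuous homeo_inv
}.

Section homeo_ops.
Context {T U V : topologicalType}.

Definition homeo_id : homeo T T :=
  @Homeo T T id id (fun=> erefl) (fun=> erefl)
    (fun=> cvg_id) (fun=> cvg_id).

Definition homeo_sym (f : homeo T U) : homeo U T :=
  Homeo (homeo_invK f) (homeoK f)
    (@homeo_inv_continuous _ _ f) (@homeo_continuous _ _ f).

Definition homeo_comp (g : homeo U V) (f : homeo T U) : homeo T V :=
  @Homeo T V (g \o f) (homeo_inv f \o homeo_inv g)
    (can_comp (homeoK g) (homeoK f)) (can_comp (homeo_invK f) (homeo_invK g))
    (fun x => continuous_comp (@homeo_continuous _ _ f x)
                              (@homeo_continuous _ _ g (f x)))
    (fun y => continuous_comp (@homeo_inv_continuous _ _ g y)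
                              (@homeo_inv_continuous _ _ f (homeo_inv g y))).

End homeo_ops.

(** * The half-line [0, +oo) *)

Definition Rplus (R : realType) : Type := set_type [set t : R | 0 <= t].

HB.instance Definition _ (R : realType) :=
  Topological.copy (Rplus R) (set_type [set t : R | 0 <= t]).

Section half_line.
Context {R : realType}.

Definition rval (t : Rplus R) : R := \val t.

Definition mkRplus (t : R) (t0 : 0 <= t) : Rplus R :=
  exist _ t (mem_set (t0 : [set t : R | 0 <= t] t)).

Lemma rval_ge0 (t : Rplus R) : 0 <= rval t.
Proof. by case: t => t tP; exact: (set_mem tP). Qed.

Lemma rval_inj : injective rval.
Proof. exact: val_inj. Qed.

Lemma rvalE (t : R) (t0 : 0 <= t) : rval (mkRplus t0) = t.
Proof. by []. Qed.

Definition Rplus0 : Rplus R := mkRplus (lexx 0).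

Definition Rplus_mul (s t : Rplus R) : Rplus R :=
  mkRplus (mulr_ge0 (rval_ge0 s) (rval_ge0 t)).

Lemma rvalM (s t : Rplus R) : rval (Rplus_mul s t) = rval s * rval t.
Proof. by []. Qed.

Definition Rplus_infty : set_system (Rplus R) :=
  filter_from setT (fun M : R => [set t | M < rval t]).

Definition proper_function (psi : Rplus R -> Rplus R) :=
  forall K : set (Rplus R), compact K -> compact (psi @^-1` K).

Definition sublinear (phi : Rplus R -> Rplus R) :=
  (fun x => rval (phi x) / rval x) @ Rplus_infty --> (0 : R).

Definition linearly_controlled (hhat : homeo (Rplus R) (Rplus R)) :=
  forall a : Rplus R, 0 < rval a ->
    (fun t => rval (hhat (Rplus_mul a (homeo_inv hhat t))) / rval t)
      @ Rplus_infty --> (1 : R).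

End half_line.

(** * The l2-product of two metric spaces *)

Definition l2prod {R : realType} (X Y : metricType R) : Type := (X * Y)%type.

Section l2_product.
Context {R : realType} (X Y : metricType R).
Local Notation XY := (l2prod X Y).

HB.instance Definition _ := Choice.copy XY (X * Y)%type.

Definition l2dist (p q : XY) : R :=
  Num.sqrt (mdist p.1 q.1 ^+ 2 + mdist p.2 q.2 ^+ 2).

Let l2distxx p : l2dist p p = 0.
Proof. by rewrite /l2dist !mdistxx expr0n/= addr0 sqrtr0. Qed.

Let l2dist_pos p q : l2dist p q = 0 -> p = q.
Proof.
case: p q => [x y] [x' y']; rewrite /l2dist/= => /eqP.
rewrite sqrtr_eq0 => le0.
have /eqP : mdist x x' ^+ 2 + mdist y y' ^+ 2 = 0.
  by apply/eqP; rewrite eq_le le0 addr_ge0// sqr_ge0.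
rewrite paddr_eq0 ?sqr_ge0// !sqrf_eq0 => /andP[/eqP xx' /eqP yy'].
by rewrite (mdist_positivity _ _ xx') (mdist_positivity _ _ yy').
Qed.

Let l2dist_sym p q : l2dist p q = l2dist q p.
Proof. by rewrite /l2dist (metric_sym p.1) (metric_sym p.2). Qed.

Lemma l2_minkowski (a b c d : R) : 0 <= a -> 0 <= b -> 0 <= c -> 0 <= d ->
  Num.sqrt ((a + c) ^+ 2 + (b + d) ^+ 2) <=
  Num.sqrt (a ^+ 2 + b ^+ 2) + Num.sqrt (c ^+ 2 + d ^+ 2).
Proof.
move=> a0 b0 c0 d0.
set u := Num.sqrt (a ^+ 2 + b ^+ 2); set v := Num.sqrt (c ^+ 2 + d ^+ 2).
have u0 : 0 <= u by exact: sqrtr_ge0.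
have v0 : 0 <= v by exact: sqrtr_ge0.
have uE : u ^+ 2 = a ^+ 2 + b ^+ 2 by rewrite sqr_sqrtr// addr_ge0// sqr_ge0.
have vE : v ^+ 2 = c ^+ 2 + d ^+ 2 by rewrite sqr_sqrtr// addr_ge0// sqr_ge0.
rewrite -[leRHS]ger0_norm ?addr_ge0// -sqrtr_sqr ler_wsqrtr//.
have cs : a * c + b * d <= u * v.
  rewrite -(@ler_pXn2r _ 2)// ?nnegrE ?addr_ge0 ?mulr_ge0//.
  rewrite exprMn uE vE -subr_ge0.
  rewrite [X in 0 <= X](_ : _ = (a * d - b * c) ^+ 2) ?sqr_ge0//; ring.
rewrite sqrrD [leRHS]sqrrD uE vE; nra.
Qed.

Let l2dist_triangle q p r : l2dist p r <= l2dist p q + l2dist q r.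
Proof.
apply: le_trans (l2_minkowski _ _ _ _); rewrite ?mdist_ge0//.
by rewrite ler_wsqrtr// lerD// ler_pXn2r ?nnegrE ?addr_ge0 ?mdist_ge0//;
  exact: metric_triangle.
Qed.

HB.instance Definition _ :=
  isMetric.Build R XY l2distxx l2dist_pos l2dist_sym l2dist_triangle.

Lemma l2distE (p q : XY) :
  mdist p q = Num.sqrt (mdist p.1 q.1 ^+ 2 + mdist p.2 q.2 ^+ 2).
Proof. by []. Qed.

End l2_product.

Section product_homeo.
Context {R : realType}.

Lemma metric_continuousP (T U : metricType R) (f : T -> U) :
  continuous f <-> forall x e, 0 < e ->
    exists2 d, 0 < d & forall y, mdist x y < d -> mdist (f x) (f y) < e.
Proof.
split=> [cf x e e0|cf x].
  have /= := cf x _ (nbhsx_ballx (f x) e e0); rewrite nbhs_simpl/=.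
  move=> /nbhs_ballP[d d0 df]; exists d => // y xy.
  by have := df y; rewrite !ballEmdist/=; exact.
move=> A /nbhs_ballP[e /= e0 eA]; have [d d0 df] := cf x e e0.
rewrite nbhs_simpl/=; apply/nbhs_ballP; exists d => // y.
by rewrite ballEmdist/= => /df xy; apply: eA; rewrite ballEmdist.
Qed.

Lemma l2prod_map_continuous (X X' Y Y' : metricType R) (f : X -> X')
    (g : Y -> Y') : continuous f -> continuous g ->
  continuous ((fun p => (f p.1, g p.2)) : l2prod X Y -> l2prod X' Y').
Proof.
move=> /metric_continuousP cf /metric_continuousP cg.
apply/metric_continuousP => -[x y] e e0.
have e2 : 0 < e / 2 by rewrite divr_gt0.
have [d d0 df] := cf x _ e2; have [d' d'0 dg] := cg y _ e2.
exists (Num.min d d'); first by rewrite lt_min d0.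
move=> [x' y'] /=; rewrite l2distE/= lt_min => /andP[xd yd].
have le1 (a b : R) : 0 <= a -> 0 <= b -> a <= Num.sqrt (a ^+ 2 + b ^+ 2).
  move=> a0 b0; rewrite -[leLHS]ger0_norm// -sqrtr_sqr ler_wsqrtr//.
  by rewrite lerDl sqr_ge0.
have fx : mdist (f x) (f x') < e / 2.
  by apply: df => /=; apply: le_lt_trans xd; rewrite le1// mdist_ge0.
have gy : mdist (g y) (g y') < e / 2.
  apply: dg => /=; apply: le_lt_trans yd; rewrite addrC le1//; exact: mdist_ge0.
rewrite l2distE/= -[ltRHS]ger0_norm ?ltW// -sqrtr_sqr ltr_sqrt ?exprn_gt0//.
have := mdist_ge0 (f x) (f x'); have := mdist_ge0 (g y) (g y').
nra.
Qed.

Definition homeo_l2prod (X X' Y Y' : metricType R) (f : homeo X X')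
    (g : homeo Y Y') : homeo (l2prod X Y) (l2prod X' Y') :=
  @Homeo (l2prod X Y) (l2prod X' Y')
    (fun p => (f p.1, g p.2)) (fun p => (homeo_inv f p.1, homeo_inv g p.2))
    (fun p => etrans (congr2 pair (homeoK f p.1) (homeoK g p.2))
                     (esym (surjective_pairing p)))
    (fun p => etrans (congr2 pair (homeo_invK f p.1) (homeo_invK g p.2))
                     (esym (surjective_pairing p)))
    (l2prod_map_continuous (@homeo_continuous _ _ f) (@homeo_continuous _ _ g))
    (l2prod_map_continuous
       (@homeo_inv_continuous _ _ f) (@homeo_inv_continuous _ _ g)).

End product_homeo.

(** * Proper CAT(0) spaces *)

Section metric_geometry.
Context {R : realType}.
Implicit Types W : metricType R.

Definition rdist W (p q : W) : Rplus R := mkRplus (mdist_ge0 p q).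

(** [c] is only relevant on [[0, d(p, q)]]. *)
Definition geodesic_between W (c : Rplus R -> W) (p q : W) :=
  [/\ c Rplus0 = p, c (rdist p q) = q &
      forall s t, rval s <= mdist p q -> rval t <= mdist p q ->
        mdist (c s) (c t) = `|rval s - rval t|].

Definition geodesic_space W := forall p q : W, exists c, geodesic_between c p q.

Definition euclidean_plane : metricType R := l2prod R^o R^o.

(** The CAT(0) inequality compares any two points of a geodesic triangle. Two
    points on the same side satisfy it trivially; two points on different sides
    lie on the two sides issuing from some vertex, here called [p]. *)
Definition CAT0 W :=
  geodesic_space W /\
  forall (p q r : W) (p' q' r' : euclidean_plane),
    mdist p' q' = mdist p q -> mdist q' r' = mdist q r ->
    mdist p' r' = mdist p r ->
  forall c1 c2 c1' c2',
    geodesic_between c1 p q -> geodesic_between c2 p r ->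
    geodesic_between c1' p' q' -> geodesic_between c2' p' r' ->
  forall s t, rval s <= mdist p q -> rval t <= mdist p r ->
    mdist (c1 s) (c2 t) <= mdist (c1' s) (c2' t).

Definition proper_space W :=
  forall (x : W) (r : R), compact [set y | mdist x y <= r].

Definition metric_isometry W (f : W -> W) :=
  forall x y, mdist (f x) (f y) = mdist x y.

Definition quasi_isometry W (f : W -> W) :=
  exists K C : R, [/\ 1 <= K, 0 <= C,
    forall x y, mdist x y / K - C <= mdist (f x) (f y) <= K * mdist x y + C &
    forall z, exists x, mdist z (f x) <= C].

Definition diam W (K : set W) : R :=
  sup [set d | exists x y, [/\ K x, K y & d = mdist x y]].

Definition compressing W (psi : Rplus R -> Rplus R) (f : homeo W W) :=
  exists phi : Rplus R -> Rplus R, sublinear phi /\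
    forall (r : Rplus R) (K : set W), compact K ->
      diam K < rval (psi r) -> diam (f @` K) < rval (phi r).

End metric_geometry.

(** * The boundary at infinity *)

Section boundary.
Context {R : realType}.

Definition is_ray (W : metricType R) (c : Rplus R -> W) :=
  forall s t, mdist (c s) (c t) = `|rval s - rval t|.

Record ray (W : metricType R) :=
  Ray { ray_fun :> Rplus R -> W; rayP : is_ray ray_fun }.

HB.instance Definition _ (W : metricType R) := gen_eqMixin (ray W).
HB.instance Definition _ (W : metricType R) := gen_choiceMixin (ray W).

Definition asymptotic (W : metricType R) (c c' : ray W) : bool :=
  `[< exists K : R, forall t, mdist (c t) (c' t) <= K >].

Section equivalence.
Variable W : metricType R.

Let asymptotic_refl : reflexive (@asymptotic W).
Proof. by move=> c; apply/asboolP; exists 0 => t; rewrite mdistxx. Qed.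

Let asymptotic_sym : symmetric (@asymptotic W).
Proof.
move=> c c'; apply/asboolP/asboolP => -[K cK]; exists K => t;
by rewrite metric_sym.
Qed.

Let asymptotic_trans : transitive (@asymptotic W).
Proof.
move=> c' c c'' /asboolP[K cK] /asboolP[K' cK']; apply/asboolP.
by exists (K + K') => t; apply: le_trans (metric_triangle _ (c' t) _) (lerD _ _).
Qed.

Canonical asymptotic_equiv :=
  EquivRel (@asymptotic W) asymptotic_refl asymptotic_sym asymptotic_trans.

End equivalence.

Definition boundary (W : metricType R) := {eq_quot (asymptotic_equiv W)}.

HB.instance Definition _ (W : metricType R) := Choice.on (boundary W).
HB.instance Definition _ (W : metricType R) := EqQuotient.on (boundary W).

(** [W] together with its boundary, with the cone topology based at [w0]. *)
Definition bordification (W : metricType R) (w0 : W) : Type :=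
  (W + boundary W)%type.

Section cone_topology.
Context {W : metricType R} (w0 : W).
Local Notation Wbar := (bordification w0).

Definition inW (w : W) : Wbar := inl w.
Definition inBd (xi : boundary W) : Wbar := inr xi.

(** The points outside the closed ball of radius [r] about [w0] whose radial
    projection to that ball is at distance less than [e] from [c r]. *)
Definition cone_nbhd (c : ray W) (r : Rplus R) (e : R) : set Wbar :=
  fun z => match z with
  | inl w => rval r < mdist w0 w /\
      exists g, geodesic_between g w0 w /\ mdist (g r) (c r) < e
  | inr xi => exists c' : ray W,
      [/\ c' Rplus0 = w0, \pi_(boundary W) c' = xi & mdist (c' r) (c r) < e]
  end.

Definition cone_subbase : set (set Wbar) :=
  [set inW @` A | A in @open W] `|`
  [set U | exists (c : ray W) (r : Rplus R) (e : R),
     [/\ c Rplus0 = w0, 0 < rval r, 0 < e & U = cone_nbhd c r e]].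

HB.instance Definition _ := gen_eqMixin Wbar.
HB.instance Definition _ := gen_choiceMixin Wbar.
HB.instance Definition _ := isSubBaseTopological.Build Wbar cone_subbase id.

(** The boundary as a subspace of the bordification. *)
Definition cone_boundary : Type := initial_topology inBd.
HB.instance Definition _ :=
  Topological.copy cone_boundary (initial_topology inBd).

Definition extends_by (f : W -> W) (F : homeo Wbar Wbar) :=
  forall w, F (inW w) = inW (f w).

Definition extends_to_boundary (f : W -> W) :=
  exists F : homeo Wbar Wbar, extends_by f F.

Definition induces_on_boundary (f : W -> W)
    (df : homeo cone_boundary cone_boundary) :=
  exists F : homeo Wbar Wbar,
    extends_by f F /\ forall xi, F (inBd xi) = inBd (df xi).

End cone_topology.

End boundary.

(** * Topological joins, with join lines parametrized by [0, +oo] *)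

Definition slope (R : realType) : Type := set_type [set m : \bar R | (0 <= m)%E].

HB.instance Definition _ (R : realType) :=
  Topological.copy (slope R) (set_type [set m : \bar R | (0 <= m)%E]).

Section join.
Context {R : realType}.

(** The disjoint union of [A], [B] and [A * B * [0, +oo]]; keeping [A] and [B]
    as summands makes the join correct when one of the two spaces is empty. *)
Inductive prejoin (A B : Type) :=
  | PJl of A
  | PJr of B
  | PJm of A & B & slope R.

HB.instance Definition _ (A B : Type) := gen_eqMixin (prejoin A B).
HB.instance Definition _ (A B : Type) := gen_choiceMixin (prejoin A B).

Section prejoin_topology.
Context {A B : topologicalType}.

Definition PJm_uncurried (p : A * B * slope R) : prejoin A B :=
  PJm p.1.1 p.1.2 p.2.

Definition prejoin_open (U : set (prejoin A B)) :=
  [/\ open (@PJl A B @^-1` U), open (@PJr A B @^-1` U) &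
      open (PJm_uncurried @^-1` U)].

Let prejoin_openT : prejoin_open setT.
Proof. by split; rewrite preimage_setT; exact: openT. Qed.

Let prejoin_openI : setI_closed prejoin_open.
Proof. by move=> U V [? ? ?] [? ? ?]; split; rewrite preimage_setI; exact: openI. Qed.

Let prejoin_open_bigU (I : Type) (f : I -> set (prejoin A B)) :
  (forall i, prejoin_open (f i)) -> prejoin_open (\bigcup_i f i).
Proof.
by move=> fo; split; rewrite preimage_bigcup; apply: bigcup_open => i _;
  have [] := fo i.
Qed.

HB.instance Definition _ := isOpenTopological.Build (prejoin A B)
  prejoin_openT prejoin_openI prejoin_open_bigU.

End prejoin_topology.

(** Canonical representatives for (a, b, 0) ~ a and (a, b, +oo) ~ b. *)
Definition join_collapse (A B : Type) (z : prejoin A B) : prejoin A B :=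
  match z with
  | PJm a b m =>
      if \val m == 0%E then PJl B a else if \val m == +oo%E then PJr A b else z
  | _ => z
  end.

Definition join_rel (A B : Type) (z z' : prejoin A B) : bool :=
  join_collapse z == join_collapse z'.

Section join_space.
Variables A B : topologicalType.

Let join_rel_refl : reflexive (@join_rel A B).
Proof. by move=> z; exact: eqxx. Qed.

Let join_rel_sym : symmetric (@join_rel A B).
Proof. by move=> z z'; exact: eq_sym. Qed.

Let join_rel_trans : transitive (@join_rel A B).
Proof. by move=> z' z z'' /eqP zz' /eqP z'z''; apply/eqP; rewrite zz'. Qed.

Canonical join_equiv :=
  EquivRel (@join_rel A B) join_rel_refl join_rel_sym join_rel_trans.

Definition join := {eq_quot join_equiv}.

HB.instance Definition _ := Topological.copy join (quotient_topology join).
HB.instance Definition _ := EqQuotient.on join.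

End join_space.

Lemma pair_map_continuous (T U T' U' : topologicalType) (f : T -> T')
    (g : U -> U') : continuous f -> continuous g ->
  continuous (fun p : T * U => (f p.1, g p.2)).
Proof.
move=> cf cg [x y] A [[P Q] /= [nP nQ] PQA].
exists (f @^-1` P, g @^-1` Q) => /=; first by split; [exact: cf|exact: cg].
by move=> [x' y'] [/= Px' Qy']; exact: PQA.
Qed.

Section join_maps.
Context {A B A' B' : topologicalType}.

Definition prejoin_map (f : A -> A') (g : B -> B') (z : prejoin A B) :
    prejoin A' B' :=
  match z with
  | PJl a => PJl B' (f a)
  | PJr b => PJr A' (g b)
  | PJm a b m => PJm (f a) (g b) m
  end.

Definition join_map (f : A -> A') (g : B -> B') (z : join A B) : join A' B' :=
  \pi_(join A' B') (prejoin_map f g (repr z)).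

Lemma join_mapE f g z :
  join_map f g (\pi_(join A B) z) = \pi_(join A' B') (prejoin_map f g z).
Proof.
have collapse_map u : join_collapse (prejoin_map f g u) =
    prejoin_map f g (join_collapse u).
  by case: u => //= a b m; case: ifP => // _; case: ifP.
rewrite /join_map; apply/eqmodP => /=; rewrite /join_rel !collapse_map.
have /eqmodP/eqP/= -> // : \pi_(join A B) (repr (\pi_(join A B) z)) =
  \pi_(join A B) z by rewrite reprK.
Qed.

Lemma join_map_continuous f g :
  continuous f -> continuous g -> continuous (join_map f g).
Proof.
move=> cf cg; apply/(@quotient_continuous _ (join A B)).
rewrite (_ : _ \o _ = \pi_(join A' B') \o prejoin_map f g); last first.
  by apply/funext => z; exact: join_mapE.
have cm : continuous (prejoin_map f g).
  apply/continuousP => U [oUl oUr oUm]; split => /=.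
  - by have /continuousP/(_ _ oUl) := cf.
  - by have /continuousP/(_ _ oUr) := cg.
  - suff /continuousP/(_ _ oUm) : continuous
        (fun p : A * B * slope R => (f p.1.1, g p.1.2, p.2)) by [].
    exact: pair_map_continuous (pair_map_continuous cf cg) (fun=> cvg_id).
by move=> z; apply: continuous_comp; [exact: cm|exact: pi_continuous].
Qed.

End join_maps.

Lemma join_mapK (A B A' B' : topologicalType) (f : A -> A') (g : B -> B') f' g' :
  cancel f f' -> cancel g g' -> cancel (join_map f g) (join_map f' g').
Proof.
move=> fK gK z; rewrite -[z]reprK (join_mapE f g) join_mapE.
by case: (repr z) => [a|b|a b m] /=; rewrite ?fK ?gK.
Qed.

Definition join_homeo (A B A' B' : topologicalType) (f : homeo A A') (g : homeo B B') :
    homeo (join A B) (join A' B') :=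
  Homeo (join_mapK (homeoK f) (homeoK g))
    (join_mapK (homeo_invK f) (homeo_invK g))
    (join_map_continuous (@homeo_continuous _ _ f) (@homeo_continuous _ _ g))
    (join_map_continuous
       (@homeo_inv_continuous _ _ f) (@homeo_inv_continuous _ _ g)).

End join.

(** * The boundary of a product as the join of the boundaries *)

Section product_boundary.
Context {R : realType} {X Y : metricType R}.

(** For a join line of slope [m = tan theta], the speeds [cos theta] and
    [sin theta] of the two components of the corresponding rays. *)
Definition slope_cos (m : slope R) : R :=
  if \val m is r%:E then (Num.sqrt (1 + r ^+ 2))^-1 else 0.

Definition slope_sin (m : slope R) : R :=
  if \val m is r%:E then r / Num.sqrt (1 + r ^+ 2) else 1.

Lemma slope_cos_ge0 m : 0 <= slope_cos m.
Proof. by rewrite /slope_cos; case: (\val m) => // r; rewrite invr_ge0 sqrtr_ge0. Qed.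

Lemma slope_sin_ge0 m : 0 <= slope_sin m.
Proof.
rewrite /slope_sin; case: m => -[r|//|//] m0 /=.
by move/set_mem : m0; rewrite /= lee_fin => r0; rewrite divr_ge0// sqrtr_ge0.
Qed.

Lemma slope_cos_sin m : slope_cos m ^+ 2 + slope_sin m ^+ 2 = 1.
Proof.
rewrite /slope_cos /slope_sin; case: (\val m) => [r||]; last 2 first.
- by rewrite expr0n expr1n add0r.
- by rewrite expr0n expr1n add0r.
have r1 : 0 < 1 + r ^+ 2 by rewrite ltr_pwDl// sqr_ge0.
rewrite exprVn exprMn exprVn sqr_sqrtr ?ltW//.
by rewrite -{1}[_^-1]mul1r -mulrDl divff// gt_eqF.
Qed.

Lemma is_ray_left (a : ray X) (y0 : Y) :
  is_ray ((fun t => (a t, y0)) : Rplus R -> l2prod X Y).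
Proof.
by move=> s t; rewrite l2distE/= mdistxx rayP expr0n addr0 sqrtr_sqr normr_id.
Qed.

Lemma is_ray_right (x0 : X) (b : ray Y) :
  is_ray ((fun t => (x0, b t)) : Rplus R -> l2prod X Y).
Proof.
by move=> s t; rewrite l2distE/= mdistxx rayP expr0n add0r sqrtr_sqr normr_id.
Qed.

Lemma is_ray_slope (a : ray X) (b : ray Y) (m : slope R) :
  is_ray ((fun t => (a (Rplus_mul (mkRplus (slope_cos_ge0 m)) t),
                     b (Rplus_mul (mkRplus (slope_sin_ge0 m)) t)))
    : Rplus R -> l2prod X Y).
Proof.
move=> s t; rewrite l2distE/= !rayP /= /rval/= -!mulrBr !normrM !exprMn.
by rewrite -mulrDl !real_normK ?num_real// slope_cos_sin mul1r sqrtr_sqr.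
Qed.

Definition prejoin_boundary (x0 : X) (y0 : Y)
    (z : prejoin (boundary X) (boundary Y)) : boundary (l2prod X Y) :=
  \pi_(boundary (l2prod X Y)) match z with
  | PJl xi => Ray (is_ray_left (repr xi) y0)
  | PJr eta => Ray (is_ray_right x0 (repr eta))
  | PJm xi eta m => Ray (is_ray_slope (repr xi) (repr eta) m)
  end.

(** The identification of the join of the boundaries of [X] and [Y] with the
    boundary of [X * Y]; it is bijective by [join_boundary_inj] and
    [join_boundary_surj] below. *)
Definition join_boundary (x0 : X) (y0 : Y)
    (z : join (cone_boundary x0) (cone_boundary y0)) :
    boundary (l2prod X Y) :=
  prejoin_boundary x0 y0 (repr z).

Lemma asymptoticP (W : metricType R) (c c' : ray W) :
  reflect (exists K : R, forall t, mdist (c t) (c' t) <= K)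
    (\pi_(boundary W) c == \pi_(boundary W) c').
Proof. by apply: (iffP eqP) => [/eqmodP/asboolP//|H]; apply/eqmodP/asboolP. Qed.

Lemma mdist_fst (p q : l2prod X Y) : mdist p.1 q.1 <= mdist p q.
Proof.
rewrite l2distE -[leLHS]ger0_norm ?mdist_ge0// -sqrtr_sqr ler_wsqrtr//.
by rewrite lerDl sqr_ge0.
Qed.

Lemma mdist_snd (p q : l2prod X Y) : mdist p.2 q.2 <= mdist p q.
Proof.
rewrite l2distE -[leLHS]ger0_norm ?mdist_ge0// -sqrtr_sqr ler_wsqrtr//.
by rewrite lerDr sqr_ge0.
Qed.

Lemma mdist_sum (p q : l2prod X Y) : mdist p q <= mdist p.1 q.1 + mdist p.2 q.2.
Proof.
have := @mdist_ge0 _ _ p.1 q.1; have := @mdist_ge0 _ _ p.2 q.2 => b0 a0.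
rewrite l2distE -[leRHS]ger0_norm ?addr_ge0// -sqrtr_sqr ler_wsqrtr//.
by rewrite sqrrD -addrA lerD2l lerDr mulrn_wge0// mulr_ge0.
Qed.

Lemma asymptotic_l2 (c c' : ray (l2prod X Y)) :
  (exists K : R, forall t, mdist (c t).1 (c' t).1 <= K) ->
  (exists K : R, forall t, mdist (c t).2 (c' t).2 <= K) ->
  \pi_(boundary (l2prod X Y)) c = \pi_(boundary (l2prod X Y)) c'.
Proof.
move=> [K cK] [K' cK']; apply/eqP/asymptoticP; exists (K + K') => t.
exact: le_trans (mdist_sum _ _) (lerD _ _).
Qed.

Lemma asymptotic_repr (W : metricType R) (c : ray W) :
  exists K : R, forall t, mdist (repr (\pi_(boundary W) c) t) (c t) <= K.
Proof. by apply/asymptoticP; rewrite reprK. Qed.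

Lemma ray_drift (W : metricType R) (c : ray W) (s : Rplus R -> Rplus R)
    (w : W) : (forall t, rval (s t) = 0) ->
  exists K : R, forall t, mdist (c (s t)) w <= K.
Proof.
move=> s0; exists (mdist (c Rplus0) w) => t.
by have -> : s t = Rplus0 by apply: rval_inj; rewrite s0.
Qed.

Lemma ray_reparam (W : metricType R) (c : ray W) (s : Rplus R -> Rplus R) :
  (forall t, rval (s t) = rval t) ->
  exists K : R, forall t, mdist (c (s t)) (c t) <= K.
Proof. by move=> st; exists 0 => t; rewrite rayP st subrr normr0. Qed.

Lemma slope0 m : \val m = 0%E -> slope_cos m = 1 /\ slope_sin m = 0.
Proof.
by rewrite /slope_cos /slope_sin => -> /=; rewrite expr0n addr0 sqrtr1 invr1 mul0r.
Qed.

Lemma slopeoo m : \val m = +oo%E -> slope_cos m = 0 /\ slope_sin m = 1.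
Proof. by rewrite /slope_cos /slope_sin => ->. Qed.

Let left_compat (a : ray X) (b : ray Y) (y0 : Y) (m : slope R) :
  \val m = 0%E -> \pi_(boundary (l2prod X Y)) (Ray (is_ray_slope a b m)) =
                  \pi_(boundary (l2prod X Y)) (Ray (is_ray_left a y0)).
Proof.
move=> /slope0[c1 s0]; apply: asymptotic_l2 => /=.
  by apply: ray_reparam => t; rewrite rvalM rvalE c1 mul1r.
by apply: ray_drift => t; rewrite rvalM rvalE s0 mul0r.
Qed.

Let right_compat (a : ray X) (b : ray Y) (x0 : X) (m : slope R) :
  \val m = +oo%E -> \pi_(boundary (l2prod X Y)) (Ray (is_ray_slope a b m)) =
                    \pi_(boundary (l2prod X Y)) (Ray (is_ray_right x0 b)).
Proof.
move=> /slopeoo[c0 s1]; apply: asymptotic_l2 => /=.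
  by apply: ray_drift => t; rewrite rvalM rvalE c0 mul0r.
by apply: ray_reparam => t; rewrite rvalM rvalE s1 mul1r.
Qed.

Lemma prejoin_boundary_collapse (x0 : X) (y0 : Y) z :
  prejoin_boundary x0 y0 (join_collapse z) = prejoin_boundary x0 y0 z.
Proof.
case: z => // xi eta m /=; case: ifPn => [/eqP m0|m0].
  by rewrite /prejoin_boundary (left_compat _ _ y0 m0).
by case: ifPn => // /eqP moo; rewrite /prejoin_boundary (right_compat _ _ x0 moo).
Qed.

Lemma join_boundaryE (x0 : X) (y0 : Y)
    (z : prejoin (cone_boundary x0) (cone_boundary y0)) :
  join_boundary (\pi_(join (cone_boundary x0) (cone_boundary y0)) z) =
  prejoin_boundary x0 y0 z.
Proof.
rewrite /join_boundary -prejoin_boundary_collapse.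
rewrite -[RHS]prejoin_boundary_collapse; congr prejoin_boundary.
by apply/eqP; have /eqmodP := reprK (\pi_(join (cone_boundary x0) (cone_boundary y0)) z).
Qed.

Let key (a b c d p q A B : R) : 0 <= a -> 0 <= b -> 0 <= c -> 0 <= d ->
  0 <= p -> 0 <= q -> 0 <= A -> 0 <= B -> A <= a + c -> B <= b + d ->
  a ^+ 2 + b ^+ 2 = p ^+ 2 -> c ^+ 2 + d ^+ 2 = q ^+ 2 ->
  A ^+ 2 + B ^+ 2 = (p + q) ^+ 2 ->
  [/\ A = a + c, B = b + d, q * a = p * c & q * b = p * d].
Proof.
move=> a0 b0 c0 d0 p0 q0 A0 B0 Aac Bbd abp cdq ABpq.
have cs : a * c + b * d <= p * q.
  rewrite -(@ler_pXn2r _ 2)// ?nnegrE ?addr_ge0 ?mulr_ge0//.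
  rewrite exprMn -abp -cdq -subr_ge0.
  rewrite [X in 0 <= X](_ : _ = (a * d - b * c) ^+ 2) ?sqr_ge0//; ring.
have A2 : A ^+ 2 <= (a + c) ^+ 2 by rewrite ler_pXn2r ?nnegrE ?addr_ge0.
have B2 : B ^+ 2 <= (b + d) ^+ 2 by rewrite ler_pXn2r ?nnegrE ?addr_ge0.
have eq2 : (p + q) ^+ 2 - ((a + c) ^+ 2 + (b + d) ^+ 2) =
    2 * (p * q - (a * c + b * d)).
  rewrite sqrrD -abp -cdq; ring.
have csE : a * c + b * d = p * q by lra.
have AE : A ^+ 2 = (a + c) ^+ 2 by lra.
have BE : B ^+ 2 = (b + d) ^+ 2 by lra.
have par : (q * a - p * c) ^+ 2 + (q * b - p * d) ^+ 2 = 0.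
  transitivity (q ^+ 2 * (a ^+ 2 + b ^+ 2) + p ^+ 2 * (c ^+ 2 + d ^+ 2)
                - 2 * (p * q) * (a * c + b * d)); first by ring.
  by rewrite abp cdq csE; ring.
move/eqP : par; rewrite paddr_eq0 ?sqr_ge0// !sqrf_eq0 !subr_eq0.
move=> /andP[/eqP qa /eqP qb]; split => //.
- by apply/eqP; rewrite -(@eqrXn2 _ 2) ?addr_ge0// AE.
- by apply/eqP; rewrite -(@eqrXn2 _ 2) ?addr_ge0// BE.
Qed.

(** The components of a geodesic ray have constant speed. *)
Lemma ray_l2_speeds (c : ray (l2prod X Y)) :
  exists a b : R, [/\ 0 <= a, 0 <= b, a ^+ 2 + b ^+ 2 = 1,
    forall s t, mdist (c s).1 (c t).1 = a * `|rval s - rval t| &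
    forall s t, mdist (c s).2 (c t).2 = b * `|rval s - rval t| ].
Proof.
pose A s t := mdist (c s).1 (c t).1; pose B s t := mdist (c s).2 (c t).2.
have A0 s t : 0 <= A s t by exact: mdist_ge0.
have B0 s t : 0 <= B s t by exact: mdist_ge0.
have AB s t : A s t ^+ 2 + B s t ^+ 2 = (rval t - rval s) ^+ 2.
  have := rayP c s t; rewrite l2distE => /(congr1 (fun x => x ^+ 2)).
  rewrite sqr_sqrtr ?addr_ge0 ?sqr_ge0// => ->.
  by rewrite real_normK ?num_real// -sqrrN opprB.
pose one : Rplus R := mkRplus ler01.
have step s t : rval s <= rval t ->
    [/\ A Rplus0 t = A Rplus0 s + A s t, B Rplus0 t = B Rplus0 s + B s t,
        rval t * A Rplus0 s = rval s * A Rplus0 t &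
        rval t * B Rplus0 s = rval s * B Rplus0 t].
  move=> st.
  have [|||||||||||||AE BE qa qb] := @key (A Rplus0 s) (B Rplus0 s) (A s t)
    (B s t) (rval s) (rval t - rval s) (A Rplus0 t) (B Rplus0 t) => //.
  - exact: rval_ge0.
  - by rewrite subr_ge0.
  - exact: metric_triangle.
  - exact: metric_triangle.
  - by rewrite AB rvalE subr0.
  - by rewrite AB rvalE subr0 addrC subrK.
  split => //; [rewrite AE | rewrite BE].
  - by move: qa; rewrite mulrBl mulrDr => <-; rewrite addrC subrK.
  - by move: qb; rewrite mulrBl mulrDr => <-; rewrite addrC subrK.
have lin t : A Rplus0 t = A Rplus0 one * rval t /\
             B Rplus0 t = B Rplus0 one * rval t.
  have [t1|/ltW t1] := leP (rval t) (rval one).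
    have [_ _] := step _ _ t1; rewrite rvalE !mul1r => -> ->.
    by split; rewrite mulrC.
  have [_ _] := step _ _ t1; rewrite rvalE !mul1r => <- <-.
  by split; rewrite mulrC.
have le s t : rval s <= rval t -> A s t = A Rplus0 one * `|rval s - rval t| /\
                                  B s t = B Rplus0 one * `|rval s - rval t|.
  move=> st; have [+ + _ _] := step _ _ st.
  have [-> ->] := lin s; have [-> ->] := lin t => At Bt.
  by rewrite distrC ger0_norm ?subr_ge0// !mulrBr At Bt; split; ring.
exists (A Rplus0 one), (B Rplus0 one); split => //.
- by rewrite AB !rvalE subr0 expr1n.
- move=> s t; have [/le[]//|/ltW/le[]] := leP (rval s) (rval t).
  by rewrite /A metric_sym distrC.
- move=> s t; have [/le[]//|/ltW/le[_]] := leP (rval s) (rval t).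
  by rewrite /B metric_sym distrC.
Qed.

Let unit_speed (W : metricType R) (f : Rplus R -> W) (a : R) (a0 : 0 < a)
    (fa : forall s t, mdist (f s) (f t) = a * `|rval s - rval t|) :
  exists c : ray W, forall t, f t = c (Rplus_mul (mkRplus (ltW a0)) t).
Proof.
have ia0 : 0 <= a^-1 by rewrite invr_ge0 ltW.
have rf : is_ray (fun t => f (Rplus_mul (mkRplus ia0) t)).
  move=> s t; rewrite fa !rvalM rvalE -mulrBr normrM (ger0_norm ia0) mulrA.
  by rewrite divff ?mul1r// gt_eqF.
exists (Ray rf) => t /=; congr f; apply: rval_inj.
by rewrite !rvalM !rvalE mulrA mulVf ?mul1r// gt_eqF.
Qed.

Let zero_speed (W : metricType R) (f : Rplus R -> W) (w : W)
    (f0 : forall s t, mdist (f s) (f t) = 0 * `|rval s - rval t|) :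
  exists K : R, forall t, mdist w (f t) <= K.
Proof.
exists (mdist w (f Rplus0)) => t.
by rewrite -(mdist_positivity (f Rplus0) (f t))// f0 mul0r.
Qed.

Lemma join_boundary_surj (x0 : X) (y0 : Y) (zeta : boundary (l2prod X Y)) :
  exists z : join (cone_boundary x0) (cone_boundary y0),
    join_boundary z = zeta.
Proof.
suff [z <-] : exists z, prejoin_boundary x0 y0 z = zeta.
  by exists (\pi z); exact: join_boundaryE.
rewrite -[zeta]reprK; set c := repr zeta.
have [a [b [a0 b0 ab ca cb]]] := ray_l2_speeds c.
have [a_eq0|a_neq0] := eqVneq a 0.
  have b1 : b = 1.
    apply/eqP; rewrite -(@eqrXn2 _ 2)// expr1n -ab a_eq0 expr0n add0r.
    by rewrite eqxx.
  have rb : is_ray (fun t => (c t).2) by move=> s t; rewrite cb b1 mul1r.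
  exists (PJr _ (\pi_(boundary Y) (Ray rb))); apply: asymptotic_l2 => /=.
    by apply: zero_speed => s t; rewrite ca a_eq0.
  exact: (asymptotic_repr (Ray rb)).
have [b_eq0|b_neq0] := eqVneq b 0.
  have a1 : a = 1.
    apply/eqP; rewrite -(@eqrXn2 _ 2)// expr1n -ab b_eq0 expr0n addr0.
    by rewrite eqxx.
  have ra : is_ray (fun t => (c t).1) by move=> s t; rewrite ca a1 mul1r.
  exists (PJl _ (\pi_(boundary X) (Ray ra))); apply: asymptotic_l2 => /=.
    exact: (asymptotic_repr (Ray ra)).
  by apply: zero_speed => s t; rewrite cb b_eq0.
have ap : 0 < a by rewrite lt_neqAle eq_sym a_neq0.
have bp : 0 < b by rewrite lt_neqAle eq_sym b_neq0.
have [ra raE] := unit_speed ap ca; have [rb rbE] := unit_speed bp cb.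
have m0 : [set m : \bar R | (0 <= m)%E] (b / a)%:E.
  by rewrite /= lee_fin divr_ge0.
pose m : slope R := exist _ (b / a)%:E (mem_set m0).
have sE : Num.sqrt (1 + (b / a) ^+ 2) = a^-1.
  rewrite expr_div_n -{1}(@divff _ (a ^+ 2)) ?expf_neq0// -mulrDl ab mul1r.
  by rewrite -exprVn sqrtr_sqr ger0_norm// invr_ge0.
have cm : slope_cos m = a by rewrite /slope_cos /= sE invrK.
have sm : slope_sin m = b by rewrite /slope_sin /= sE invrK divfK.
exists (PJm (\pi_(boundary X) ra) (\pi_(boundary Y) rb) m).
apply: asymptotic_l2 => /=.
  have [K HK] := asymptotic_repr ra; exists K => t; rewrite raE.
  suff -> : mkRplus (ltW ap) = mkRplus (slope_cos_ge0 m) by exact: HK.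
  by apply: rval_inj; rewrite !rvalE cm.
have [K HK] := asymptotic_repr rb; exists K => t; rewrite rbE.
suff -> : mkRplus (ltW bp) = mkRplus (slope_sin_ge0 m) by exact: HK.
by apply: rval_inj; rewrite !rvalE sm.
Qed.

Let bounded_mul (a K : R) : (forall t : Rplus R, a * rval t <= K) -> a <= 0.
Proof.
move=> aK; rewrite leNgt; apply/negP => a0.
have t0 : 0 <= (`|K| + 1) / a by rewrite divr_ge0 ?addr_ge0// ltW.
have := aK (mkRplus t0); rewrite rvalE mulrC divfK ?gt_eqF// => {}aK.
by have := le_trans aK (ler_norm K); rewrite gerDl ler10.
Qed.

Let const_speed (W : metricType R) (c : ray W) (a : Rplus R) (w : W) :
  (exists K : R, forall t, mdist (c (Rplus_mul a t)) w <= K) -> rval a = 0.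
Proof.
move=> [K cK]; apply/eqP; rewrite eq_le rval_ge0 andbT.
apply: (@bounded_mul _ (K + mdist w (c Rplus0))) => t.
apply: le_trans (lerD (cK t) (lexx _)); apply: le_trans (metric_triangle _ _ _).
by rewrite rayP rvalM rvalE subr0 ler_norm.
Qed.

Let speed_le (W : metricType R) (c c' : ray W) (a a' : Rplus R) :
  (exists K : R, forall t,
     mdist (c (Rplus_mul a t)) (c' (Rplus_mul a' t)) <= K) ->
  rval a <= rval a'.
Proof.
move=> [K cK]; rewrite -subr_le0.
apply: (@bounded_mul _ (K + mdist (c' Rplus0) (c Rplus0))) => t.
have h1 := cK t.
have h2 := metric_triangle (c (Rplus_mul a t)) (c' (Rplus_mul a' t)) (c Rplus0).
have h3 := metric_triangle (c' (Rplus_mul a' t)) (c' Rplus0) (c Rplus0).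
move: h2 h3; rewrite !rayP !rvalM !rvalE !subr0 !ger0_norm ?mulr_ge0 ?rval_ge0//.
lra.
Qed.

Let same_speed (W : metricType R) (xi xi' : boundary W) (a a' : Rplus R) :
  0 < rval a ->
  (exists K : R, forall t, mdist (repr xi (Rplus_mul a t))
                             (repr xi' (Rplus_mul a' t)) <= K) ->
  a = a' /\ xi = xi'.
Proof.
move=> a0 H.
have aa' : a = a'.
  apply: rval_inj; apply/eqP; rewrite eq_le (speed_le H)/=.
  apply: (@speed_le _ (repr xi') (repr xi)).
  by have [K HK] := H; exists K => t; rewrite metric_sym.
split=> //; rewrite -[xi]reprK -[xi']reprK; apply/eqP/asymptoticP.
have [K HK] := H; exists K => t.
have ia0 : 0 <= (rval a)^-1 by rewrite invr_ge0 ltW.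
have := HK (Rplus_mul (mkRplus ia0) t); rewrite -aa'.
suff -> : Rplus_mul a (Rplus_mul (mkRplus ia0) t) = t by [].
by apply: rval_inj; rewrite !rvalM rvalE mulrA divff ?mul1r// gt_eqF.
Qed.

Let asymptotic_fst (c c' : ray (l2prod X Y)) :
  \pi_(boundary (l2prod X Y)) c = \pi_(boundary (l2prod X Y)) c' ->
  exists K : R, forall t, mdist (c t).1 (c' t).1 <= K.
Proof.
move=> /eqP/asymptoticP[K HK]; exists K => t.
exact: le_trans (mdist_fst _ _) (HK t).
Qed.

Let asymptotic_snd (c c' : ray (l2prod X Y)) :
  \pi_(boundary (l2prod X Y)) c = \pi_(boundary (l2prod X Y)) c' ->
  exists K : R, forall t, mdist (c t).2 (c' t).2 <= K.
Proof.
move=> /eqP/asymptoticP[K HK]; exists K => t.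
exact: le_trans (mdist_snd _ _) (HK t).
Qed.

Let bounded_sym (W : metricType R) (f g : Rplus R -> W) :
  (exists K : R, forall t, mdist (f t) (g t) <= K) ->
  exists K : R, forall t, mdist (g t) (f t) <= K.
Proof. by move=> [K HK]; exists K => t; rewrite metric_sym. Qed.

Let ray_one (W : metricType R) (c : ray W) t :
  c t = c (Rplus_mul (mkRplus ler01) t).
Proof. by congr (c _); apply: rval_inj; rewrite rvalM rvalE mul1r. Qed.

Let ray_bounded (W : metricType R) (c : ray W) (w : W) :
  ~ exists K : R, forall t, mdist (c t) w <= K.
Proof.
move=> [K HK]; have /const_speed := ex_intro _ K
  (fun t => eq_rect _ (fun u => mdist u w <= K) (HK t) _ (ray_one c t)).
by rewrite rvalE => /eqP; rewrite oner_eq0.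
Qed.

Let same_ray (W : metricType R) (xi xi' : boundary W) :
  (exists K : R, forall t, mdist (repr xi t) (repr xi' t) <= K) -> xi = xi'.
Proof.
by move=> H; rewrite -[xi]reprK -[xi']reprK; apply/eqP/asymptoticP.
Qed.

Let slope_pos (m : slope R) : \val m != 0%E -> \val m != +oo%E ->
  0 < slope_cos m /\ 0 < slope_sin m.
Proof.
rewrite /slope_cos /slope_sin; case: m => -[r|//|//] m0 /= r0 _.
  have {}r0 : 0 < r.
    by move/set_mem : m0; rewrite /= lee_fin lt_neqAle eq_sym andbC => ->.
  have s0 : 0 < Num.sqrt (1 + r ^+ 2).
    by rewrite sqrtr_gt0 ltr_pwDl// sqr_ge0.
  by rewrite invr_gt0 divr_gt0.
by move/set_mem : m0.
Qed.

Let slope_inj (m m' : slope R) : 0 < slope_cos m ->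
  slope_cos m = slope_cos m' -> slope_sin m = slope_sin m' -> m = m'.
Proof.
move=> c0 cc ss; apply: val_inj => /=.
have c0' : 0 < slope_cos m' by rewrite -cc.
have slopeE (n : slope R) : 0 < slope_cos n ->
    \val n = (slope_sin n / slope_cos n)%:E.
  rewrite /slope_cos /slope_sin; case: (\val n) => [r||]; rewrite ?ltxx//.
  by move=> r0; rewrite invrK divfK// gt_eqF// -invr_gt0.
by rewrite slopeE// (slopeE m')// cc ss.
Qed.

Let prejoin_boundary_inj (x0 : X) (y0 : Y) z z' :
  prejoin_boundary x0 y0 z = prejoin_boundary x0 y0 z' ->
  join_collapse z = join_collapse z'.
Proof.
have lm xi xi' eta' m' : \val m' != 0%E -> \val m' != +oo%E ->
    prejoin_boundary x0 y0 (PJl _ xi) <>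
    prejoin_boundary x0 y0 (PJm xi' eta' m').
  move=> m0 moo /asymptotic_snd/bounded_sym/const_speed; rewrite rvalE => s0.
  by have [_] := slope_pos m0 moo; rewrite s0 ltxx.
have rm eta xi' eta' m' : \val m' != 0%E -> \val m' != +oo%E ->
    prejoin_boundary x0 y0 (PJr _ eta) <>
    prejoin_boundary x0 y0 (PJm xi' eta' m').
  move=> m0 moo /asymptotic_fst/bounded_sym/const_speed; rewrite rvalE => c0.
  by have [+ _] := slope_pos m0 moo; rewrite c0 ltxx.
have lr xi eta : prejoin_boundary x0 y0 (PJl _ xi) <>
    prejoin_boundary x0 y0 (PJr _ eta).
  by move=> /asymptotic_fst/ray_bounded.
rewrite -(prejoin_boundary_collapse _ _ z) -(prejoin_boundary_collapse _ _ z').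
have normal (u : @prejoin R (boundary X) (boundary Y)) : if join_collapse u is PJm _ _ m
    then \val m != 0%E /\ \val m != +oo%E else True.
  by case: u => //= xi eta m; case: ifPn => // m0; case: ifPn.
move: (normal z) (normal z'); case: (join_collapse z) => [xi|eta|xi eta m];
  case: (join_collapse z') => [xi'|eta'|xi' eta' m'].
- by move=> _ _ /asymptotic_fst/same_ray ->.
- by move=> _ _ /lr.
- by move=> _ [m0 moo] /lm; case.
- by move=> _ _ /esym/lr.
- by move=> _ _ /asymptotic_snd/same_ray ->.
- by move=> _ [m0 moo] /rm; case.
- by move=> [m0 moo] _ /esym/lm; case.
- by move=> [m0 moo] _ /esym/rm; case.
- move=> [m0 moo] [m0' moo'] E; have [c0 s0] := slope_pos m0 moo.
  have [cE ->] := @same_speed _ xi xi' (mkRplus (slope_cos_ge0 m))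
    (mkRplus (slope_cos_ge0 m')) c0 (asymptotic_fst E).
  have [sE ->] := @same_speed _ eta eta' (mkRplus (slope_sin_ge0 m))
    (mkRplus (slope_sin_ge0 m')) s0 (asymptotic_snd E).
  move/(congr1 rval) : cE; move/(congr1 rval) : sE; rewrite !rvalE => sE cE.
  by congr PJm; exact: slope_inj.
Qed.

Lemma join_boundary_inj (x0 : X) (y0 : Y) :
  injective (@join_boundary x0 y0).
Proof.
move=> z z'; rewrite -[z]reprK -[z']reprK !join_boundaryE.
by move=> /prejoin_boundary_inj E; apply/eqmodP/eqP.
Qed.
End product_boundary.

(** * Open cones and radial compressibility *)

Section open_cone.
Context {R : realType} (L : topologicalType).

Definition cone_rel (p q : L * Rplus R) : bool :=
  (p == q) || (rval p.2 == 0) && (rval q.2 == 0).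

Let cone_rel_refl : reflexive cone_rel.
Proof. by move=> p; rewrite /cone_rel eqxx. Qed.

Let cone_rel_sym : symmetric cone_rel.
Proof. by move=> p q; rewrite /cone_rel eq_sym andbC. Qed.

Let cone_rel_trans : transitive cone_rel.
Proof.
move=> q p r /orP[/eqP->//|/andP[p0 q0]] /orP[/eqP<-|/andP[_ r0]];
by rewrite /cone_rel p0 ?q0 ?r0 orbT.
Qed.

Canonical cone_equiv :=
  EquivRel cone_rel cone_rel_refl cone_rel_sym cone_rel_trans.

Definition open_cone := {eq_quot cone_equiv}.

HB.instance Definition _ := Topological.copy open_cone (quotient_topology open_cone).
HB.instance Definition _ := EqQuotient.on open_cone.

Definition cone_pt (l : L) (t : Rplus R) : open_cone := \pi_open_cone (l, t).

End open_cone.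

Section radial.
Context {R : realType} {L : topologicalType} {Y : metricType R}.
Implicit Type Theta : homeo (@open_cone R L) Y.

(** An open cone structure witnessing that [Y] is radially compressible
    toward [y0]. *)
Definition radial_cone_structure (y0 : Y) Theta :=
  compact [set: L] /\
  forall l, Theta (cone_pt l Rplus0) = y0 /\
            is_ray (fun t => Theta (cone_pt l t)).

Definition radial_homeo Theta (hhat : homeo (Rplus R) (Rplus R))
    (f : homeo Y Y) :=
  forall l t, f (Theta (cone_pt l t)) = Theta (cone_pt l (hhat t)).

End radial.

(* Main.v *)
Require Import Defs.
From mathcomp Require Import all_boot all_order all_algebra generic_quotient.
From mathcomp Require Import all_classical all_reals all_analysis.
From mathcomp Require Import ring lra.
Import Order.TTheory GRing.Theory Num.Theory.
Import numFieldNormedType.Exports.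

(** Every point at infinity of the product is a join point: a direction [xi] of
    [X], a direction [eta] of [Y] and a slope, and a point [(x, y)] tends to it
    exactly when [mdist x0 x] and [mdist y0 y] are asymptotically in the ratio
    given by the slope, while each coordinate that carries a positive share of
    the distance tends to its direction ([cone_cvg_l2P] with [frac_cvg_cone] and
    [cone_cvg_frac]). A product of two homeomorphisms therefore extends to the
    join, by the join of their boundary maps, as soon as each of them extends to
    the boundary of its factor and preserves the distance to the base point up to
    a factor tending to [1] ([product_extension]).

    The isometry [h1] has both properties ([isometry_extends],
    [isometry_asym_norm]). Conjugating [h2] by the radial homeomorphism [hpsi]
    does not change its boundary map, because [hpsi] slides points along the
    geodesics from [y0] and so extends by the identity of the boundary
    ([radial_extends]). It does repair the distances: a quasi-isometry distorts
    the distance [s] to [y0] by a factor bounded away from [0] and infinity, and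
    linear control says that [hhat (a * s)] and [hhat s] are asymptotic for every
    constant [a] ([conjugate_asym_norm]).

    The geometry rests on one inequality, the CAT(0) condition written as a law
    of cosines for points of two sides of a triangle ([CAT0_cosine_law]). It
    passes to products ([cosine_law_l2]) and yields uniqueness of geodesics,
    their linear spreading ([fan_dist]), and the existence of a ray from the
    base point in each class ([asymptotic_ray_from]). With these, continuity of
    a map of bordifications at a boundary point only has to be tested along
    points of the space ([bordification_map_continuous]). *)

Set Implicit Arguments.
Unset Strict Implicit.
Unset Printing Implicit Defensive.
Local Open Scope classical_set_scope.
Local Open Scope ring_scope.
Local Open Scope quotient_scope.

(** * Geodesic segments and the law of cosines *)

Section Segments.
Context {R : realType}.
Implicit Type W : metricType R.

Lemma max0_ge0 (t : R) : 0 <= Num.max t 0.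
Proof. by rewrite le_max lexx orbT. Qed.

(** The retraction of the line onto the half-line: it makes points at a given
    real distance along a ray available without a sign proof in the term. *)
Definition Rpos (t : R) : Rplus R := mkRplus (max0_ge0 t).

Lemma RposE t : 0 <= t -> rval (Rpos t) = t.
Proof. by move=> t0; rewrite rvalE; apply/max_idPl. Qed.

(** The point at distance [r] from [p] on a geodesic from [p] to [q]. Saying
    this with distances only, rather than with a parametrized geodesic, is what
    lets the notion be computed coordinatewise in a product. *)
Definition at_dist W (r : R) (p q u : W) :=
  mdist p u = r /\ mdist u q = mdist p q - r.

(** The same point, located by the fraction of the segment it cuts off; unlike
    the distance, this fraction is the same for both coordinates of a point of a
    product. *)
Definition at_frac W (s : R) (p q u : W) :=
  mdist p u = s * mdist p q /\ mdist u q = (1 - s) * mdist p q.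

(** The CAT(0) inequality with the comparison triangle eliminated: for [u] and
    [v] on two sides issuing from [p], the right-hand side is the squared
    distance of the comparison points, by the Euclidean law of cosines. This
    form is additive in squared distances, hence inherited by products. *)
Definition cosine_law W := forall (p q r u v : W) (s t : R),
  0 <= s -> s <= 1 -> 0 <= t -> t <= 1 -> at_frac s p q u -> at_frac t p r v ->
  mdist u v ^+ 2 <= s ^+ 2 * mdist p q ^+ 2 + t ^+ 2 * mdist p r ^+ 2
    - s * t * (mdist p q ^+ 2 + mdist p r ^+ 2 - mdist q r ^+ 2).

Lemma at_distE W r (p q u : W) : 0 < mdist p q ->
  at_dist r p q u <-> at_frac (r / mdist p q) p q u.
Proof.
move=> d0; rewrite /at_dist /at_frac mulrBl divfK ?gt_eqF// mul1r.
by [].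
Qed.

Lemma geodesic_at_dist W g (p q : W) (r : Rplus R) :
  geodesic_between g p q -> rval r <= mdist p q -> at_dist (rval r) p q (g r).
Proof.
move=> [g0 gd gi] rd; split.
  rewrite -[X in mdist X _]g0 gi ?rvalE ?mdist_ge0// sub0r normrN ger0_norm//.
  exact: rval_ge0.
rewrite -[X in mdist _ X]gd gi// rvalE distrC ger0_norm// subr_ge0//.
Qed.

(** Two geodesics meeting at [u] without excess length concatenate to a
    geodesic. *)
Lemma geodesic_through W (p q u : W) (r : R) : geodesic_space W ->
  at_dist r p q u -> exists g, geodesic_between g p q /\ g (Rpos r) = u.
Proof.
move=> gW [pu uq].
have r0 : 0 <= r by rewrite -pu mdist_ge0.
have rd : r <= mdist p q by rewrite -subr_ge0 -uq mdist_ge0.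
have [g1 [g10 g1d g1i]] := gW p u; have [g2 [g20 g2d g2i]] := gW u q.
have Er : rdist p u = Rpos r by apply: rval_inj; rewrite RposE.
pose g t := if rval t <= r then g1 t else g2 (Rpos (rval t - r)).
have gr : g (Rpos r) = u by rewrite /g RposE// lexx -Er.
have g0 : g Rplus0 = p by rewrite /g r0.
have gd : g (rdist p q) = q.
  rewrite /g /= rvalE; case: ifP => [dr|/negbT].
    have rE : r = mdist p q by apply/eqP; rewrite eq_le rd dr.
    have -> : rdist p q = rdist p u by apply: rval_inj; rewrite !rvalE pu.
    by rewrite g1d; apply: mdist_positivity; rewrite uq rE subrr.
  by rewrite -ltNge => rd'; rewrite -[RHS]g2d; congr g2; apply: rval_inj;
    rewrite RposE ?subr_ge0// rvalE uq.
exists g; split => //; split => //.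
have up s t : rval s <= rval t -> rval t <= mdist p q ->
    mdist (g s) (g t) <= rval t - rval s.
  move=> st td; have [tr|rt] := leP (rval t) r.
    rewrite /g tr (le_trans st tr) g1i ?pu ?(le_trans st tr)//.
    by rewrite distrC ger0_norm ?subr_ge0.
  have [sr|rs] := leP (rval s) r; last first.
    have gE w : r < rval w -> g w = g2 (Rpos (rval w - r)).
      by move=> rw; rewrite /g leNgt rw.
    rewrite !gE// g2i ?RposE ?uq ?lerD2r ?subr_ge0 ?(ltW rs) ?(ltW rt)//.
      by rewrite distrC ger0_norm; lra.
    exact: le_trans td.
  have -> : g s = g1 s by rewrite /g sr.
  have -> : g t = g2 (Rpos (rval t - r)) by rewrite /g leNgt rt.
  apply: le_trans (metric_triangle _ u _) _.
  rewrite -{1}g1d Er g1i ?pu ?RposE// -{1}g20.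
  rewrite g2i ?uq ?rvalE ?RposE ?subr_ge0 ?(ltW rt)//.
    rewrite distrC ger0_norm ?subr_ge0// sub0r normrN.
    have /max_idPl -> : 0 <= rval t - r by rewrite subr_ge0 ltW.
    by rewrite ger0_norm ?subr_ge0 ?(ltW rt)//; lra.
  by have /max_idPl -> : 0 <= rval t - r; rewrite ?subr_ge0 ?(ltW rt)// lerD2r.
have main s t : rval s <= rval t -> rval t <= mdist p q ->
    mdist (g s) (g t) = rval t - rval s.
  move=> st td; apply/eqP; rewrite eq_le up//=.
  have := up Rplus0 s (rval_ge0 _) (le_trans st td).
  have := up t (rdist p q) td (lexx _); rewrite g0 gd rvalE subr0.
  have := metric_triangle p (g s) q; have := metric_triangle (g s) (g t) q.
  lra.
move=> s t sd td; have [st|/ltW ts] := leP (rval s) (rval t).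
  by rewrite main// distrC ger0_norm ?subr_ge0.
by rewrite metric_sym main// ger0_norm ?subr_ge0.
Qed.

Lemma mdistRo (x y : R^o) : mdist x y = `|y - x|.
Proof. by []. Qed.

Lemma planar_geodesic (q : @euclidean_plane R) (a : R) : 0 < a ->
  q.1 ^+ 2 + q.2 ^+ 2 = a ^+ 2 ->
  geodesic_between (fun t : Rplus R =>
    (rval t / a * q.1, rval t / a * q.2) : @euclidean_plane R)
    ((0, 0) : @euclidean_plane R) q.
Proof.
move=> a0 qa.
have dq : mdist ((0,0) : @euclidean_plane R) q = a.
  rewrite l2distE !mdistRo /= !subr0 !real_normK ?num_real// qa sqrtr_sqr.
  by rewrite ger0_norm// ltW.
split.
- by rewrite !rvalE !mul0r.
- by rewrite !rvalE dq divff ?gt_eqF// !mul1r; case: q {qa dq}.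
- move=> s t _ _; rewrite l2distE !mdistRo /= !real_normK ?num_real//.
  rewrite -!mulrBl [X in Num.sqrt X](_ : _ = (rval t - rval s) ^+ 2).
    by rewrite sqrtr_sqr distrC.
  by rewrite !exprMn -mulrDr qa -!exprMn divfK ?gt_eqF.
Qed.

(** The comparison triangle is placed in the plane with [p] at the origin, [q]
    on the first axis and [r] at the angle whose cosine is dictated by the three
    side lengths; the triangle inequalities say that this cosine is in
    [[-1, 1]]. *)
Lemma CAT0_cosine_law W : CAT0 W -> cosine_law W.
Proof.
move=> [gW cat] p q r u v s t s0 s1 t0 t1 [pu uq] [pv vr].
set a := mdist p q in pu uq *; set b := mdist p r in pv vr *.
set d := mdist q r.
have a0 : 0 <= a by exact: mdist_ge0.
have b0 : 0 <= b by exact: mdist_ge0.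
have d0 : 0 <= d by exact: mdist_ge0.
have dab : d <= a + b.
  by rewrite /a (metric_sym p q); exact: metric_triangle.
have abd : a <= b + d.
  by rewrite /d (metric_sym q r); exact: metric_triangle.
have bad : b <= a + d by exact: metric_triangle.
have [aE|an0] := eqVneq a 0.
  have <- : p = u by apply: mdist_positivity; rewrite pu aE mulr0.
  have <- : b = d by apply: le_anti; move: abd bad dab; rewrite aE; lra.
  by rewrite pv aE expr0n/= mulr0 !add0r subrr mulr0 subr0 exprMn.
have [bE|bn0] := eqVneq b 0.
  have <- : p = v by apply: mdist_positivity; rewrite pv bE mulr0.
  have <- : a = d by apply: le_anti; move: abd bad dab; rewrite bE; lra.
  rewrite metric_sym pu bE expr0n/= mulr0 !addr0 subrr mulr0 subr0 exprMn//.
have {}a0 : 0 < a by rewrite lt_neqAle eq_sym an0.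
have {}b0 : 0 < b by rewrite lt_neqAle eq_sym bn0.
pose co := (a ^+ 2 + b ^+ 2 - d ^+ 2) / (2 * a * b).
have abco : 2 * a * b * co = a ^+ 2 + b ^+ 2 - d ^+ 2.
  by rewrite /co mulrC divfK// !mulf_neq0// pnatr_eq0.
have co1 : co ^+ 2 <= 1.
  have ab0 : 0 < 2 * a * b by rewrite !mulr_gt0.
  have : co <= 1 by rewrite ler_pdivrMr// mul1r; nra.
  have : -1 <= co by rewrite ler_pdivlMr// mulN1r; nra.
  nra.
clearbody co; pose si : R := Num.sqrt (1 - co ^+ 2).
have sico : co ^+ 2 + si ^+ 2 = 1.
  by rewrite sqr_sqrtr ?subr_ge0// addrC subrK.
pose p' : @euclidean_plane R := (0, 0).
pose q' : @euclidean_plane R := (a, 0).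
pose r' : @euclidean_plane R := (b * co, b * si).
have qE : q'.1 ^+ 2 + q'.2 ^+ 2 = a ^+ 2 by rewrite /= expr0n addr0.
have rE : r'.1 ^+ 2 + r'.2 ^+ 2 = b ^+ 2.
  have : (b * co) ^+ 2 + (b * si) ^+ 2 = b ^+ 2 by rewrite !exprMn -mulrDr sico mulr1.
  exact.
have dist0 (z : @euclidean_plane R) c : 0 < c -> z.1 ^+ 2 + z.2 ^+ 2 = c ^+ 2 ->
    mdist p' z = c.
  move=> c0 zc; rewrite l2distE !mdistRo /= !subr0 !real_normK ?num_real//.
  by rewrite zc sqrtr_sqr ger0_norm// ltW.
have qr : mdist q' r' = d.
  rewrite l2distE !mdistRo /= !real_normK ?num_real//.
  rewrite [X in Num.sqrt X](_ : _ = d ^+ 2); first by rewrite sqrtr_sqr ger0_norm.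
  transitivity (b ^+ 2 * (co ^+ 2 + si ^+ 2) + a ^+ 2 - 2 * a * b * co).
    by ring.
  by rewrite sico abco; ring.
have sa0 : 0 <= s * a by rewrite mulr_ge0// ltW.
have tb0 : 0 <= t * b by rewrite mulr_ge0// ltW.
have [|c1 [c1g c1u]] := @geodesic_through W p q u (s * a) gW.
  by split=> //; rewrite uq mulrBl mul1r.
have [|c2 [c2g c2v]] := @geodesic_through W p r v (t * b) gW.
  by split=> //; rewrite vr mulrBl mul1r.
have := cat p q r p' q' r' (dist0 _ _ a0 qE) qr (dist0 _ _ b0 rE) c1 c2 _ _
  c1g c2g (planar_geodesic a0 qE) (planar_geodesic b0 rE) (Rpos (s * a)) (Rpos (t * b)).
rewrite !RposE// c1u c2v => /(_ _ _)/[dup] H _.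
have {H} : mdist u v <= mdist
    ((s * a / a * q'.1, s * a / a * q'.2) : @euclidean_plane R)
    ((t * b / b * r'.1, t * b / b * r'.2) : @euclidean_plane R).
  by apply: H; rewrite ?ler_piMl// ltW.
rewrite !mulfK ?gt_eqF// l2distE !mdistRo !real_normK ?num_real//= => H.
have := @lerXn2r _ 2 _ _ (mdist_ge0 u v) (sqrtr_ge0 _) H.
rewrite sqr_sqrtr ?addr_ge0 ?sqr_ge0// => /le_trans; apply.
rewrite -abco le_eqVlt; apply/orP; left; apply/eqP.
transitivity (s ^+ 2 * a ^+ 2 + t ^+ 2 * b ^+ 2 * (co ^+ 2 + si ^+ 2)
  - s * t * (2 * a * b * co)); first by ring.
by rewrite sico mulr1.
Qed.

Lemma cosine_fan W (p q r u v : W) (s : R) : cosine_law W ->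
  0 <= s -> s <= 1 -> at_frac s p q u -> at_frac s p r v ->
  mdist u v <= s * mdist q r.
Proof.
move=> cW s0 s1 su sv; have H := cW _ _ _ _ _ _ _ s0 s1 s0 s1 su sv.
rewrite -(@ler_pXn2r _ 2)// ?nnegrE ?mulr_ge0 ?mdist_ge0//.
by apply: le_trans H _; rewrite le_eqVlt; apply/orP; left; apply/eqP; ring.
Qed.

(** For points at equal distances from the apex the law of cosines involves the
    far side only through its square minus that of the difference of the two
    other sides. When [q] and [r] move away along a common ray this grows
    linearly, against the product of two lengths on the left; this is what makes
    the geodesics to points running along a ray converge. *)
Lemma cosine_at_dist W (p q r u v : W) (s : R) : cosine_law W ->
  0 <= s -> s <= mdist p q -> s <= mdist p r ->
  at_dist s p q u -> at_dist s p r v ->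
  mdist p q * mdist p r * mdist u v ^+ 2 <=
  s ^+ 2 * (mdist q r ^+ 2 - (mdist p q - mdist p r) ^+ 2).
Proof.
move=> cW s0 sq sr su sv.
have deg z w : at_dist s p z w -> mdist p z = 0 -> s = 0.
  by move=> [pw wz] z0; have := mdist_ge0 w z; rewrite wz z0; lra.
have [q0|qn0] := eqVneq (mdist p q) 0.
  by rewrite (deg _ _ su q0) q0 expr0n/= !mul0r.
have [r0|rn0] := eqVneq (mdist p r) 0.
  by rewrite (deg _ _ sv r0) r0 expr0n/= mulr0 !mul0r.
have q0 : 0 < mdist p q by rewrite lt_neqAle eq_sym qn0 mdist_ge0.
have r0 : 0 < mdist p r by rewrite lt_neqAle eq_sym rn0 mdist_ge0.
have /(at_distE _ _ q0) su' := su; have /(at_distE _ _ r0) sv' := sv.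
have := cW _ _ _ _ _ _ _ _ _ _ _ su' sv'.
rewrite !divr_ge0 ?(ltW q0) ?(ltW r0)// !ler_pdivrMr ?mul1r// => /(_ isT sq isT sr).
move=> /(ler_wpM2l (ltW (mulr_gt0 q0 r0)))/le_trans; apply.
rewrite le_eqVlt; apply/orP; left; apply/eqP; field.
by rewrite qn0 rn0.
Qed.

Lemma at_dist_le W (p q r u v : W) (s : R) : cosine_law W ->
  0 <= s -> s <= mdist p q -> s <= mdist p r ->
  at_dist s p q u -> at_dist s p r v -> mdist u v <= mdist q r.
Proof.
move=> cW s0 sq sr su sv.
have H := cosine_at_dist cW s0 sq sr su sv.
have [s0'|sn0] := eqVneq s 0.
  have pu : p = u by apply: mdist_positivity; rewrite su.1.
  have pv : p = v by apply: mdist_positivity; rewrite sv.1.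
  by rewrite -pu -pv mdistxx mdist_ge0.
have {sn0} sp : 0 < s by rewrite lt_neqAle eq_sym sn0.
rewrite -(@ler_pXn2r _ 2)// ?nnegrE ?mdist_ge0//.
have ab0 : 0 < mdist p q * mdist p r by rewrite mulr_gt0//; exact: lt_le_trans sp _.
rewrite -(ler_pM2l ab0); apply: le_trans H _.
have : s ^+ 2 <= mdist p q * mdist p r.
  by rewrite expr2; apply: ler_pM.
have := sqr_ge0 (mdist p q - mdist p r); have := sqr_ge0 (mdist q r).
have := sqr_ge0 s; move: (_ ^+ 2) (mdist q r ^+ 2) (_ ^+ 2) => x y z.
nra.
Qed.

Lemma at_dist_uniq W (p q u v : W) (s : R) : cosine_law W -> 0 <= s ->
  s <= mdist p q -> at_dist s p q u -> at_dist s p q v -> u = v.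
Proof.
move=> cW s0 sq su sv; apply: mdist_positivity; apply/eqP.
rewrite eq_le mdist_ge0 andbT; apply: le_trans (at_dist_le cW s0 sq sq su sv) _.
by rewrite mdistxx.
Qed.

Lemma ray_at_dist W (c : ray W) (s t : Rplus R) : rval s <= rval t ->
  at_dist (rval s) (c Rplus0) (c t) (c s).
Proof.
move=> st; rewrite /at_dist !rayP rvalE !sub0r !normrN [`|_ - rval t|]distrC.
by rewrite !ger0_norm ?rval_ge0 ?subr_ge0.
Qed.

End Segments.

(** * Geodesic rays *)

Section Rays.
Context {R : realType}.
Implicit Type W : metricType R.

Lemma at_dist_rev W (p q u : W) (r : R) : at_dist r p q u ->
  at_dist (mdist p q - r) q p u.
Proof.
by move=> [pu uq]; split; rewrite 1?metric_sym// (metric_sym q p) pu subKr.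
Qed.

Lemma at_dist_sub W (p q u v : W) (r s : R) : cosine_law W -> geodesic_space W ->
  0 <= r -> r <= s -> s <= mdist p q -> at_dist r p q u -> at_dist s p q v ->
  at_dist r p v u.
Proof.
move=> cW gW r0 rs sq ru sv.
have s0 := le_trans r0 rs.
have [g [gg gv]] := geodesic_through gW sv.
have ug : u = g (Rpos r).
  apply: (at_dist_uniq cW r0 (le_trans rs sq) ru).
  have := @geodesic_at_dist _ _ g p q (Rpos r) gg.
  by rewrite RposE//; apply; exact: le_trans sq.
split; first by rewrite ru.1.
have [_ _ gi] := gg.
rewrite ug -gv gi ?RposE//; last exact: le_trans sq.
rewrite gv sv.1.
by rewrite distrC ger0_norm ?subr_ge0.
Qed.

(** Geodesics issuing from one point spread at least linearly. *)
Lemma fan_dist W (p q r u v : W) (s t : R) : cosine_law W ->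
  0 <= s -> s <= t -> 0 < t -> mdist p q = t -> mdist p r = t ->
  at_dist s p q u -> at_dist s p r v -> t * mdist u v <= s * mdist q r.
Proof.
move=> cW s0 st t0 pq pr su sv.
have q0 : 0 < mdist p q by rewrite pq.
have r0 : 0 < mdist p r by rewrite pr.
move/(at_distE _ _ q0): su; move/(at_distE _ _ r0): sv; rewrite pq pr => sv su.
have st1 : s / t <= 1 by rewrite ler_pdivrMr// mul1r.
have := cosine_fan cW (divr_ge0 s0 (ltW t0)) st1 su sv.
by move=> /(ler_wpM2l (ltW t0)); rewrite mulrA mulrCA divff ?gt_eqF// mulr1.
Qed.

(** By spreading, a point of the geodesic to [w] that is boundedly far from
    [c s] for a large [s] forces closeness to [c r] at a fixed radius [r]. *)
Lemma shadow_contract W (w u v : W) (c : ray W) (r s : Rplus R) :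
  cosine_law W -> geodesic_space W ->
  rval r <= rval s -> 0 < rval s -> rval s <= mdist (c Rplus0) w ->
  at_dist (rval r) (c Rplus0) w u -> at_dist (rval s) (c Rplus0) w v ->
  rval s * mdist u (c r) <= rval r * mdist v (c s).
Proof.
move=> cW gW rs s0 sw ru sv.
apply: (fan_dist cW (rval_ge0 _) rs s0 sv.1) => //.
- by rewrite rayP rvalE sub0r normrN ger0_norm// rval_ge0.
- exact: (at_dist_sub cW gW (rval_ge0 _) rs sw ru sv).
- exact: ray_at_dist.
Qed.

(** Moving the origin of a geodesic with a fixed end moves its points by a
    bounded amount: the two geodesics converge towards their common end, and
    the reparametrization caused by their different lengths costs at most
    [mdist p p'] once more. *)
Lemma shared_end W (p p' q u v : W) (s : R) : cosine_law W -> geodesic_space W ->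
  0 <= s -> s <= mdist p q -> s <= mdist p' q ->
  at_dist s p q u -> at_dist s p' q v -> mdist u v <= 2 * mdist p p'.
Proof.
move=> cW gW s0.
wlog le : p p' u v / mdist p q <= mdist p' q.
  move=> H sp sp' su sv; have [le|/ltW le] := leP (mdist p q) (mdist p' q).
    exact: (H p p' u v).
  by rewrite metric_sym (metric_sym p p'); exact: (H p' p v u).
move=> sp sp' su sv.
have [g [gg gv]] := geodesic_through gW sv.
pose t := mdist p' q - (mdist p q - s).
have st : s <= t by rewrite /t; lra.
have t0 := le_trans s0 st.
have tq : t <= mdist p' q by rewrite /t; lra.
have gt : at_dist t p' q (g (Rpos t)).
  by have := @geodesic_at_dist _ _ g p' q (Rpos t) gg; rewrite RposE//; apply.
have gt' := at_dist_rev gt; have su' := at_dist_rev su.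
have e : mdist p' q - t = mdist p q - s by rewrite /t; lra.
rewrite e in gt'.
have h1 : mdist u (g (Rpos t)) <= mdist p p'.
  apply: (at_dist_le cW _ _ _ su' gt'); rewrite ?subr_ge0//.
    by rewrite (metric_sym q p); lra.
  by rewrite (metric_sym q p'); lra.
have h2 : mdist (g (Rpos t)) v = mdist p' q - mdist p q.
  by have [_ _ gi] := gg; rewrite -gv gi ?RposE// /t ger0_norm; lra.
have := metric_triangle u (g (Rpos t)) v; have := metric_triangle p' p q.
rewrite (metric_sym p' p); lra.
Qed.

Lemma Rplus_large (M : R) : exists t : Rplus R, M < rval t.
Proof.
exists (Rpos (`|M| + 1)); rewrite RposE ?addr_ge0//.
by have := ler_norm M; lra.
Qed.

(** Linear spreading is incompatible with staying at bounded distance. *)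
Lemma asymptotic_same_base W (c c' : ray W) : cosine_law W ->
  c Rplus0 = c' Rplus0 -> \pi_(boundary W) c = \pi_(boundary W) c' ->
  forall t, c t = c' t.
Proof.
move=> cW cc' /eqP/asymptoticP[K HK] s.
have [//|ne] := eqVneq (c s) (c' s).
have d0 : 0 < mdist (c s) (c' s) by rewrite mdist_gt0.
have [t tM] := Rplus_large (Num.max (rval s) (rval s * K / mdist (c s) (c' s))).
move: tM; rewrite gt_max ltr_pdivrMr// => /andP[st tK].
have t0 : 0 < rval t by apply: le_lt_trans st; exact: rval_ge0.
have len (b : ray W) : mdist (b Rplus0) (b t) = rval t.
  by rewrite rayP rvalE sub0r normrN ger0_norm// rval_ge0.
have := fan_dist cW (rval_ge0 s) (ltW st) t0 (len c) _
  (ray_at_dist c (ltW st)).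
rewrite cc' => /(_ _ _ (len c') (ray_at_dist c' (ltW st))) H.
have := le_trans H (ler_wpM2l (rval_ge0 s) (HK t)).
by rewrite leNgt tK.
Qed.

#[global] Instance Rplus_infty_filter : ProperFilter (@Rplus_infty R).
Proof.
apply: filter_from_proper; last first.
  by move=> M _; have [t] := Rplus_large M; exists t.
apply: filter_from_filter; first by exists 0.
move=> M N _ _; exists (Num.max M N) => // t /=.
by rewrite gt_max => /andP[].
Qed.

Lemma near_infty (M : R) : \forall t \near (@Rplus_infty R), M < rval t.
Proof. by exists M. Qed.

(** The ray is the limit of the geodesics [g t] from [w0] to [c t]. At each
    parameter [s] the points [g t s] form a Cauchy family by [cosine_at_dist],
    and properness provides their limit; the limit ray stays close to [c] since
    every [g t] does, by [shared_end]. *)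
Lemma asymptotic_ray_from W (w0 : W) (c : ray W) :
  proper_space W -> cosine_law W -> geodesic_space W ->
  exists c' : ray W, c' Rplus0 = w0 /\ \pi_(boundary W) c' = \pi_(boundary W) c.
Proof.
move=> pW cW gW.
pose D := mdist w0 (c Rplus0).
have D0 : 0 <= D by exact: mdist_ge0.
have /choice[g gP] : forall t, exists g, geodesic_between g w0 (c t).
  by move=> t; exact: gW.
have clen t : `|mdist w0 (c t) - rval t| <= D.
  have e : mdist (c Rplus0) (c t) = rval t.
    by rewrite rayP rvalE sub0r normrN ger0_norm// rval_ge0.
  have := metric_triangle w0 (c Rplus0) (c t).
  have := metric_triangle (c Rplus0) w0 (c t).
  rewrite (metric_sym _ w0) -/D e ler_norml; lra.
have gat t s : rval s <= mdist w0 (c t) -> at_dist (rval s) w0 (c t) (g t s).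
  by move=> st; exact: geodesic_at_dist.
have cau s (e : R) : 0 < e -> exists T,
    \forall t \near @Rplus_infty R, mdist (g T s) (g t s) < e.
  move=> e0.
  (* Past this threshold the lengths [a], [b] of [g T], [g t] are at least half
     of [T], [t], which turns [cosine_at_dist] into
     [T * mdist (g T s) (g t s) ^+ 2 <= 16 * D * s ^+ 2]. *)
  pose M := 1 + 2 * D + 2 * rval s + 16 * D * rval s ^+ 2 / e ^+ 2.
  have [T TM] := Rplus_large M; exists T.
  apply: filterS (near_infty (rval T)) => t /= Tt.
  have s0 := rval_ge0 s.
  have e2 : 0 < e ^+ 2 by rewrite exprn_gt0.
  have M1 : 0 <= 16 * D * rval s ^+ 2 / e ^+ 2.
    by apply: divr_ge0; [rewrite !mulr_ge0// sqr_ge0|exact: ltW].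
  have TM2 : 16 * D * rval s ^+ 2 < e ^+ 2 * rval T.
    by rewrite [ltRHS]mulrC -ltr_pdivrMr//; move: TM; rewrite /M; lra.
  have := clen T; have := clen t; rewrite !ler_norml => /andP[t1 t2] /andP[T1 T2].
  have sT : rval s <= mdist w0 (c T) by move: TM; rewrite /M; lra.
  have st : rval s <= mdist w0 (c t) by move: TM; rewrite /M; lra.
  have := cosine_at_dist cW s0 sT st (gat _ _ sT) (gat _ _ st).
  rewrite rayP distrC ger0_norm ?subr_ge0 ?(ltW Tt)//.
  have aT : rval T <= 2 * mdist w0 (c T) by move: TM; rewrite /M; lra.
  have bt : rval t <= 2 * mdist w0 (c t) by move: TM; rewrite /M; lra.
  have T0 : 0 < rval T by move: TM; rewrite /M; lra.
  rewrite -[_ < e](@ltr_pXn2r _ 2)// ?nnegrE ?mdist_ge0 ?(ltW e0)//.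
  have tri : `|mdist w0 (c t) - mdist w0 (c T)| <= rval t - rval T.
    have e' : mdist (c T) (c t) = rval t - rval T.
      by rewrite rayP distrC ger0_norm ?subr_ge0 ?(ltW Tt).
    have := metric_triangle w0 (c T) (c t); have := metric_triangle w0 (c t) (c T).
    by rewrite (metric_sym (c t)) e' ler_norml; lra.
  move: tri; rewrite ler_norml => /andP[tri1 tri2].
  have := sqr_ge0 (mdist (g T s) (g t s)); move: (mdist (g T s) _ ^+ 2) => x x0.
  move: aT bt t1 t2 T1 T2 tri1 tri2 {st sT}.
  move: (mdist w0 (c T)) (mdist w0 (c t)) => a b aT bt t1 t2 T1 T2 tri1 tri2 H.
  have h1 : (rval t - rval T) ^+ 2 - (a - b) ^+ 2 <= 4 * D * rval t.
    have -> : (rval t - rval T) ^+ 2 - (a - b) ^+ 2 =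
        (rval t - rval T - (b - a)) * (rval t - rval T + (b - a)) by ring.
    have -> : 4 * D * rval t = (2 * D) * (2 * rval t) by ring.
    by apply: ler_pM; lra.
  have h2 : rval T * rval t * x <= 4 * (a * b * x).
    rewrite !mulrA ler_wpM2r//.
    have -> : 4 * a * b = (2 * a) * (2 * b) by ring.
    by apply: ler_pM => //; rewrite ltW// (lt_trans T0).
  have h3 : rval T * rval t * x <= 16 * D * rval s ^+ 2 * rval t.
    apply: le_trans h2 _; apply: le_trans (ler_wpM2l _ H) _ => //.
    have := ler_wpM2l (sqr_ge0 (rval s)) h1; lra.
  have t0 := lt_trans T0 Tt.
  have h4 : rval T * x <= 16 * D * rval s ^+ 2.
    by rewrite -(ler_pM2r t0); apply: le_trans h3; rewrite mulrAC.
  by rewrite -(ltr_pM2r T0) mulrC; exact: le_lt_trans TM2.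
have lim s : exists l, forall e : R, 0 < e ->
    \forall t \near @Rplus_infty R, mdist (g t s) l < e.
  have [|l [_ cl]] := pW w0 (rval s) ((fun t => g t s) @ @Rplus_infty R).
    apply: filterS (near_infty (rval s + D)) => t /= st.
    have := clen t; rewrite ler_norml => /andP[t1 t2].
    by rewrite (gat _ _ _).1//; lra.
  exists l => e e0; have e4 : 0 < e / 4 by rewrite divr_gt0.
  have [T HT] := cau s _ e4.
  have [z [/= zT zl]] := cl [set z | mdist (g T s) z < e / 4] _ HT (nbhsx_ballx l _ e4).
  move: zl; rewrite ballEmdist /= => zl; apply: filterS HT => t /= tT.
  have := metric_triangle (g t s) (g T s) l; have := metric_triangle (g T s) z l.
  rewrite (metric_sym (g t s) (g T s)) (metric_sym z l); lra.
have /choice[c' app] := lim.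
have rc' : is_ray c'.
  move=> s s'; apply/eqP; rewrite -subr_eq0 -normr_le0; apply/ler_addgt0Pr => e e0.
  have e2 : 0 < e / 2 by rewrite divr_gt0.
  near (@Rplus_infty R) => t.
  have h1 : mdist (g t s) (c' s) < e / 2 by near: t; exact: (app _ _ _).
  have h2 : mdist (g t s') (c' s') < e / 2 by near: t; exact: (app _ _ _).
  have h3 : rval s + rval s' + D < rval t by near: t; exact: near_infty.
  have h4 : mdist (g t s) (g t s') = `|rval s - rval s'|.
    have := clen t; rewrite ler_norml => /andP[t1 t2].
    have := rval_ge0 s; have := rval_ge0 s' => s0 s'0.
    by have [_ _ ->//] := gP t; lra.
  have := metric_triangle (g t s) (c' s) (g t s').
  have := metric_triangle (c' s) (c' s') (g t s').
  have := metric_triangle (c' s) (g t s) (c' s').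
  have := metric_triangle (g t s) (g t s') (c' s').
  rewrite (metric_sym (c' s) (g t s)) (metric_sym (c' s') (g t s')) add0r ler_norml.
  lra.
exists (Ray rc'); split.
  apply: mdist_positivity; apply/eqP; rewrite eq_le mdist_ge0 andbT.
  apply/ler_addgt0Pr => e e0; near (@Rplus_infty R) => t.
  rewrite add0r metric_sym /=.
  have [g0 _ _] := gP t; rewrite -[X in mdist X _]g0; apply: ltW.
  by near: t; exact: (app _ _ _).
apply/eqP/asymptoticP; exists (2 * D + 1) => s /=.
near (@Rplus_infty R) => t.
have h1 : mdist (g t s) (c' s) < 1 by near: t; exact: (app _ _ _).
have st : rval s + D < rval t by near: t; exact: near_infty.
have := clen t; rewrite ler_norml => /andP[t1 t2].
have sc : rval s <= mdist w0 (c t) by lra.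
have st' : rval s <= rval t by lra.
have h2 : mdist (g t s) (c s) <= 2 * D.
  apply: (shared_end cW gW (rval_ge0 s) sc _ (gat _ _ sc)) (ray_at_dist c st').
  by rewrite rayP rvalE sub0r normrN ger0_norm// rval_ge0.
have := metric_triangle (c' s) (g t s) (c s); rewrite (metric_sym (c' s) (g t s)); lra.
Unshelve. all: by end_near.
Qed.

End Rays.

(** * Convergence to boundary points *)

Section Bordification.
Context {R : realType} {W : metricType R} (w0 : W).
Local Notation Wbar := (bordification w0).

Lemma cone_subbase_open A : @cone_subbase R W w0 A -> open A.
Proof.
move=> bA; exists [set A]; last exact: bigcup_set1.
by move=> _ ->; exact: (@finI_from1 _ _ (@cone_subbase R W w0) id).
Qed.

Lemma cvg_cone_subbase (F : set_system Wbar) (z : Wbar) {FF : Filter F} :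
  (forall A, @cone_subbase R W w0 A -> A z -> F A) -> F --> z.
Proof.
move=> FA U; rewrite nbhsE => -[B [oB Bz] BU]; apply: filterS BU _.
case: oB Bz => D' D'D <- [i D'i iz]; have [E ED Ei] := D'D i D'i.
apply: (@filterS _ _ _ i); first by move=> y iy; exists i.
rewrite -Ei; apply: filter_bigI => A EA; apply: FA.
  by have := ED A EA; rewrite inE.
by move: iz; rewrite -Ei; apply.
Qed.

Lemma cone_nbhd_open (c : ray W) (r : Rplus R) (e : R) :
  c Rplus0 = w0 -> 0 < rval r -> 0 < e -> open (cone_nbhd c r e : set Wbar).
Proof. by move=> c0 r0 e0; apply: cone_subbase_open; right; exists c, r, e. Qed.

Lemma inW_open (U : set W) : open U -> open (inW w0 @` U).
Proof. by move=> oU; apply: cone_subbase_open; left; exists U. Qed.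

(** Convergence of points of [W] to the end of a ray issuing from [w0]. *)
Definition cone_cvg (F : set_system W) (c : ray W) := forall (r : Rplus R) (e : R),
  0 < rval r -> 0 < e -> F [set w | cone_nbhd c r e (inW w0 w)].

(** Properness would give the last property by [asymptotic_ray_from]; it is
    kept separate because a product gets it from its factors. *)
Hypotheses (gW : geodesic_space W) (cW : cosine_law W)
  (rW : forall c : ray W, exists c' : ray W,
     c' Rplus0 = w0 /\ \pi_(boundary W) c' = \pi_(boundary W) c).

Lemma cone_nbhdP (c : ray W) (r : Rplus R) (e : R) (w : W) :
  cone_nbhd c r e (inW w0 w) <-> rval r < mdist w0 w /\
    exists u, at_dist (rval r) w0 w u /\ mdist u (c r) < e.
Proof.
split=> -[rw].
  move=> [g [gg ge]]; split=> //; exists (g r); split => //.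
  exact: geodesic_at_dist gg (ltW rw).
move=> [u [ru ue]]; split=> //; have [g [gg gu]] := geodesic_through gW ru.
exists g; split => //; suff -> : g r = u by [].
by rewrite -gu; congr g; apply: rval_inj; rewrite RposE// rval_ge0.
Qed.

Lemma boundary_ray (xi : boundary W) :
  exists c : ray W, c Rplus0 = w0 /\ \pi_(boundary W) c = xi.
Proof. by have [c [c0 cxi]] := rW (repr xi); exists c; rewrite cxi reprK. Qed.

(** The subbasic neighborhoods of a boundary point may be centred at other rays;
    uniqueness of the ray from [w0] in a class recentres them at [c]. *)
Lemma cvg_inBdP (F : set_system W) (c : ray W) {FF : Filter F} : c Rplus0 = w0 ->
  inW w0 @ F --> inBd w0 (\pi_(boundary W) c) <-> cone_cvg F c.
Proof.
move=> c0; split=> [Fc r e r0 e0|Fc].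
  apply: Fc; apply: open_nbhs_nbhs; split; first exact: cone_nbhd_open.
  by exists c; rewrite mdistxx.
apply: cvg_cone_subbase => A [[U _ <-] [//]|[c1 [r [e [c10 r0 e0 ->]]]]].
move=> [c' [c'0 c'c c'e]]; have cc' : c' r = c r.
  by apply: asymptotic_same_base => //; rewrite c0.
rewrite cc' in c'e; have {}e0 : 0 < e - mdist (c r) (c1 r) by rewrite subr_gt0.
have := Fc _ _ r0 e0; apply: (@filterS _ F) => w /=.
move=> /cone_nbhdP[rw [u [ru ue]]].
apply/cone_nbhdP; split => //; exists u; split => //.
have := metric_triangle u (c r) (c1 r); lra.
Qed.

(** In particular [W] is dense in its bordification. *)
Lemma cvg_ray (c : ray W) : c Rplus0 = w0 ->
  inW w0 (c t) @[t --> @Rplus_infty R] --> inBd w0 (\pi_(boundary W) c).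
Proof.
move=> c0; apply/(cvg_inBdP (F := c @ @Rplus_infty R) c0) => r e r0 e0.
apply: filterS (near_infty (rval r)) => t /= rt; apply/cone_nbhdP.
rewrite -c0 rayP rvalE sub0r normrN ger0_norm ?rval_ge0//; split=> //.
by exists (c r); rewrite mdistxx; split=> //; exact: ray_at_dist (ltW rt).
Qed.

Lemma inW_continuous : continuous (inW w0).
Proof.
move=> w; apply: cvg_cone_subbase => A [[U oU <-] [w' Uw' [<-]]|].
  apply: (@filterS _ _ _ U); last exact: open_nbhs_nbhs.
  by move=> z Uz /=; exists z.
move=> [c [r [e [c0 r0 e0 ->]]]] /cone_nbhdP[rw [u [ru ue]]].
apply/nbhs_ballP; exists (Num.min (mdist w0 w - rval r) (e - mdist u (c r))) => /=.
  by rewrite lt_min !subr_gt0 rw.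
move=> w'; rewrite ballEmdist /= lt_min => /andP[ww' ww''].
have rw' : rval r < mdist w0 w'.
  have := metric_triangle w0 w' w; rewrite (metric_sym w' w); lra.
apply/cone_nbhdP; split=> //; have [g gg] := gW w0 w'.
have ru' := geodesic_at_dist gg (ltW rw'); exists (g r); split=> //.
have := at_dist_le cW (rval_ge0 r) (ltW rw) (ltW rw') ru ru'.
have := metric_triangle (g r) u (c r); rewrite (metric_sym (g r) u); lra.
Qed.

Definition bordification_map (f : W -> W) (d : boundary W -> boundary W)
    (z : Wbar) : Wbar :=
  match z with inl w => inW w0 (f w) | inr xi => inBd w0 (d xi) end.

(** Continuity of [f], extended by [xi |-> eta], at [xi] along [W]. *)
Definition boundary_limit (f : W -> W) (xi eta : boundary W) :=
  forall F : set_system W, Filter F ->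
    inW w0 @ F --> inBd w0 xi -> inW w0 (f w) @[w --> F] --> inBd w0 eta.

(** The definition of [boundary_limit] quantifies over filters so that it composes
    and transfers easily; tested on the trace of the neighborhoods of [xi] it
    gives back a genuine neighborhood. *)
Lemma boundary_limit_nbhs f xi eta (c : ray W) (r : Rplus R) (e : R) :
  boundary_limit f xi eta -> c Rplus0 = w0 -> \pi_(boundary W) c = eta ->
  0 < rval r -> 0 < e ->
  nbhs (inBd w0 xi)
    [set z | forall w, z = inW w0 w -> cone_nbhd c r e (inW w0 (f w))].
Proof.
move=> fxi c0 ceta r0 e0.
(* The trace on [W] of the neighborhoods of [xi]. *)
pose F : set_system W := [set B : set W |
  \forall z \near inBd w0 xi, forall w, z = inW w0 w -> B w].
have FF : Filter F.
  split.
  - by apply: (@filterS _ (nbhs (inBd w0 xi)) _ setT) => //; exact: filterT.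
  - move=> A B; apply: (@filterS2 _ (nbhs (inBd w0 xi))) => z zA zB w zw.
    by split; [exact: zA|exact: zB].
  - by move=> A B AB; apply: (@filterS _ (nbhs (inBd w0 xi))) => z zA w /zA/AB.
have Fxi : inW w0 @ F --> inBd w0 xi.
  by move=> A; apply: filterS => z Az w zw; rewrite /= -zw.
have := fxi F FF Fxi; rewrite -ceta => /(cvg_inBdP (F := f @ F) c0); exact.
Qed.

(** Only limits along [W] have to be checked. For a boundary point [zeta] near
    [xi], a point [w] of [W] close to [zeta] is still near [xi], so [f w] is in
    the given neighborhood of [d xi]; and [f w] is close to [d zeta]. The two
    rays involved are then compared through the unique point of the geodesic to
    [f w] at the given radius. *)
Lemma bordification_map_continuous (f : W -> W) (d : boundary W -> boundary W) :
  continuous f -> (forall xi, boundary_limit f xi (d xi)) ->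
  continuous (bordification_map f d).
Proof.
move=> cf fd z; have [[w ->]|[xi ->]] : (exists w, z = inW w0 w) \/
    (exists xi, z = inBd w0 xi) by case: z => [w|xi]; [left; exists w|right; exists xi].
  move=> A /= /inW_continuous/cf; rewrite nbhs_simpl /= nbhsE => -[U [oU Uw] UA].
  rewrite nbhs_simpl/=.
  apply: (@filterS _ _ _ (inW w0 @` U)); first by move=> _ [w' Uw' <-]; exact: UA.
  by apply: open_nbhs_nbhs; split; [exact: inW_open|exists w].
have FF : Filter (bordification_map f d @ inBd w0 xi).
  exact: (fmap_filter _ (nbhs_filter (inBd w0 xi))).
apply: cvg_cone_subbase => A [[U _ <-] [//]|[c1 [r [e [c10 r0 e0 ->]]]]].
move=> [c' [c'0 c'd c'e]].
pose e' := (e - mdist (c' r) (c1 r)) / 2.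
have e'0 : 0 < e' by rewrite divr_gt0 ?subr_gt0.
have := boundary_limit_nbhs (fd xi) c'0 c'd r0 e'0.
rewrite {1}nbhsE => -[V [oV Vxi] Vf].
apply: (@filterS _ (nbhs (inBd w0 xi)) _ V); last exact: open_nbhs_nbhs.
move=> [w Vw|zeta Vzeta].
  have /cone_nbhdP[rw [u [ru ue]]] := Vf _ Vw w erefl.
  apply/cone_nbhdP; split=> //; exists u; split=> //.
  have := metric_triangle u (c' r) (c1 r); move: ue c'e; rewrite /e'; lra.
have [c'' [c''0 c''d]] := boundary_ray (d zeta).
have nV : nbhs (inBd w0 zeta) V by apply: open_nbhs_nbhs.
have [b [b0 bzeta]] := boundary_ray zeta.
have := @filterI _ _ (nbhs_filter (inBd w0 zeta)) _ _ nV
  (boundary_limit_nbhs (fd zeta) c''0 c''d r0 e'0).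
rewrite -bzeta => /(cvg_ray b0)/(@filter_ex _ (@Rplus_infty R) _ _)[t [Vt ft]].
have /cone_nbhdP[rw [u [ru ue]]] := Vf _ Vt _ erefl.
have /cone_nbhdP[_ [v [rv ve]]] := ft _ erefl.
exists c''; split=> //; first by rewrite c''d bzeta.
have uv : u = v := at_dist_uniq cW (rval_ge0 r) (ltW rw) ru rv.
have := metric_triangle (c'' r) v (c1 r); have := metric_triangle v (c' r) (c1 r).
move: ue ve c'e; rewrite uv (metric_sym (c'' r) v) /e'; lra.
Qed.

Lemma bordification_homeo (f : homeo W W) (d d' : boundary W -> boundary W) :
  cancel d d' -> cancel d' d ->
  (forall xi, boundary_limit f xi (d xi)) ->
  (forall xi, boundary_limit (homeo_inv f) xi (d' xi)) ->
  exists F : homeo Wbar Wbar,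
    extends_by f F /\ forall xi, F (inBd w0 xi) = inBd w0 (d xi).
Proof.
move=> dK d'K fd f'd'.
have K : cancel (bordification_map f d) (bordification_map (homeo_inv f) d').
  by case=> [w|xi] /=; rewrite ?dK ?homeoK.
have K' : cancel (bordification_map (homeo_inv f) d') (bordification_map f d).
  by case=> [w|xi] /=; rewrite ?d'K ?homeo_invK.
by exists (Homeo K K'
  (bordification_map_continuous (@homeo_continuous _ _ f) fd)
  (bordification_map_continuous (@homeo_inv_continuous _ _ f) f'd')).
Qed.

Lemma extension_boundary_limit (f : W -> W) (F : homeo Wbar Wbar) xi eta :
  extends_by f F -> F (inBd w0 xi) = inBd w0 eta -> boundary_limit f xi eta.
Proof.
move=> fF Fxi E FE Exi; rewrite -Fxi.
have -> : (fun w => inW w0 (f w)) = F \o inW w0 by apply/funext => w; rewrite -fF.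
apply: cvg_comp Exi _; exact: homeo_continuous.
Qed.

End Bordification.

Section BoundaryHomeo.
Context {R : realType} {W : metricType R} (w0 : W).
Local Notation Wbar := (bordification w0).

Lemma extension_sym (f : homeo W W) (F : homeo Wbar Wbar) :
  extends_by f F -> extends_by (homeo_sym f) (homeo_sym F).
Proof.
by move=> fF w /=; apply: (can_inj (homeoK F)); rewrite homeo_invK fF homeo_invK.
Qed.

Lemma extends_by_comp (f g : W -> W) (F G : homeo Wbar Wbar) :
  extends_by f F -> extends_by g G -> extends_by (f \o g) (homeo_comp F G).
Proof. by move=> fF gG w; rewrite /= gG fF. Qed.

(** The extension permutes [W], hence its complement. *)
Lemma extension_preserves_boundary (f : homeo W W) (F : homeo Wbar Wbar) xi :
  extends_by f F -> exists eta, F (inBd w0 xi) = inBd w0 eta.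
Proof.
move=> fF; case E : (F (inBd w0 xi)) => [w|eta]; last by exists eta.
have := extension_sym fF w; rewrite /= -[inW w0 w]/(inl w : Wbar) -E homeoK.
by [].
Qed.

Lemma extension_boundary_homeo (f : homeo W W) (F : homeo Wbar Wbar) :
  extends_by f F -> exists df : homeo (cone_boundary w0) (cone_boundary w0),
    forall xi, F (inBd w0 xi) = inBd w0 (df xi).
Proof.
move=> fF.
have /choice[d dP] := fun xi => extension_preserves_boundary xi fF.
have /choice[d' d'P] := fun xi => extension_preserves_boundary xi (extension_sym fF).
have inj xi eta : inBd w0 xi = inBd w0 eta -> xi = eta by move=> [].
have K : cancel d d'.
  by move=> xi; apply: inj; rewrite -d'P -dP /= homeoK.
have K' : cancel d' d.
  by move=> xi; apply: inj; rewrite -dP -d'P /= homeo_invK.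
have cont (e : cone_boundary w0 -> cone_boundary w0) (E : homeo Wbar Wbar) :
    (forall xi, E (inBd w0 xi) = inBd w0 (e xi)) -> continuous e.
  move=> eE; apply: continuous_comp_initial.
  have -> : inBd w0 \o e = E \o inBd w0 by apply/funext => xi; rewrite /= eE.
  move=> xi; apply: continuous_comp; first exact: initial_continuous.
  exact: homeo_continuous.
by exists (@Homeo (cone_boundary w0) (cone_boundary w0) d d' K K'
   (cont d F dP) (cont d' (homeo_sym F) d'P)).
Qed.

End BoundaryHomeo.

(** * Isometries *)

Section Isometry.
Context {R : realType} {W : metricType R} (w0 : W).
Hypotheses (pW : proper_space W) (gW : geodesic_space W) (cW : cosine_law W).

Let rW (c : ray W) : exists c' : ray W,
  c' Rplus0 = w0 /\ \pi_(boundary W) c' = \pi_(boundary W) c :=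
  asymptotic_ray_from w0 c pW cW gW.

Lemma isometry_ray (f : W -> W) (c : ray W) : metric_isometry f ->
  is_ray (fun t => f (c t)).
Proof. by move=> fi s t; rewrite fi rayP. Qed.

Definition isometry_boundary (f : W -> W) (fi : metric_isometry f)
    (xi : boundary W) : boundary W :=
  \pi_(boundary W) (Ray (isometry_ray (repr xi) fi)).

(** An isometry carries cone neighborhoods based at [w0] to cone neighborhoods
    based at [f w0]. Returning to the base point [w0] displaces geodesics and
    rays by a bounded amount, which becomes negligible after contracting from a
    large radius [S] to the given radius [r]. *)
Lemma isometry_boundary_limit (f : W -> W) (fi : metric_isometry f) xi :
  boundary_limit w0 f xi (isometry_boundary fi xi).
Proof.
move=> F FF Fxi; have [c [c0 cxi]] := boundary_ray rW xi.
have [c' [c'0 c'xi]] := boundary_ray rW (isometry_boundary fi xi).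
have [K HK] : exists K : R, forall t, mdist (f (c t)) (c' t) <= K.
  have := c'xi => /esym/eqP/asymptoticP[K1 H1].
  have := asymptotic_repr c; rewrite cxi => -[K2 H2].
  exists (K2 + K1) => t; apply: le_trans (metric_triangle _ (f (repr xi t)) _) _.
  by apply: lerD; [rewrite fi metric_sym|exact: H1].
rewrite -c'xi; apply/(cvg_inBdP gW cW (F := f @ F) c'0) => r e r0 e0.
move: Fxi; rewrite -cxi => /(cvg_inBdP gW cW c0) Fc.
pose D := mdist w0 (f w0); have D0 : 0 <= D by exact: mdist_ge0.
have K0 : 0 <= K by exact: le_trans (mdist_ge0 _ _) (HK r).
(* [S] is large enough for [r / S * (2 * D + 1 + K) < e]. *)
pose S := Rpos (rval r + rval r * (2 * D + 1 + K) / e).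
have q0 : 0 <= rval r * (2 * D + 1 + K) / e.
  by apply: divr_ge0; [apply: mulr_ge0; lra|exact: ltW].
have SE : rval S = rval r + rval r * (2 * D + 1 + K) / e by rewrite RposE; lra.
have S0 : 0 < rval S by lra.
have SD : 0 < rval (Rpos (rval S + D)) by rewrite RposE; lra.
have := @filterI _ F FF _ _ (Fc S _ S0 ltr01) (Fc (Rpos (rval S + D)) _ SD ltr01).
apply: (@filterS _ F) => w [] /= /(cone_nbhdP _ gW)[Sw [u [ru ue]]].
move=> /(cone_nbhdP _ gW)[]; rewrite RposE; last by lra.
move=> SDw _; have Sfw : rval S < mdist w0 (f w).
  have := metric_triangle (f w0) w0 (f w); rewrite fi (metric_sym _ w0) -/D; lra.
have [g gg] := gW w0 (f w).
have rS : rval r <= rval S by lra.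
have vS := geodesic_at_dist gg (ltW Sfw).
have vr := geodesic_at_dist gg (le_trans rS (ltW Sfw)).
have ru' : at_dist (rval S) (f w0) (f w) (f u) by rewrite /at_dist !fi.
have uv : mdist (f u) (g S) <= 2 * D.
  rewrite /D metric_sym.
  by apply: (shared_end cW gW (rval_ge0 S) (ltW Sfw) _ vS ru'); rewrite fi ltW.
have vc : mdist (g S) (c' S) <= 2 * D + 1 + K.
  have := metric_triangle (g S) (f u) (c' S).
  have := metric_triangle (f u) (f (c S)) (c' S); have := HK S.
  rewrite fi (metric_sym (g S) (f u)); lra.
apply/(cone_nbhdP _ gW); split; first exact: le_lt_trans Sfw.
exists (g r); split=> //.
rewrite -c'0 in vr vS Sfw.
have := shadow_contract cW gW rS S0 (ltW Sfw) vr vS.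
rewrite -(ltr_pM2l S0) => /le_lt_trans; apply.
apply: le_lt_trans (ler_wpM2l (rval_ge0 r) vc) _.
have -> : rval S * e = rval r * e + rval r * (2 * D + 1 + K).
  by rewrite SE [LHS]mulrDl divfK ?gt_eqF.
have := mulr_gt0 r0 e0; lra.
Qed.

Lemma isometry_boundaryK (f f' : W -> W) (fi : metric_isometry f)
    (fi' : metric_isometry f') : cancel f f' ->
  cancel (isometry_boundary fi) (isometry_boundary fi').
Proof.
move=> fK xi; rewrite -[RHS]reprK; apply/eqP/asymptoticP => /=.
have := asymptotic_repr (Ray (isometry_ray (repr xi) fi)) => -[K HK].
by exists K => t; rewrite -{1}(fK (repr xi t)) fi'; exact: HK.
Qed.

Lemma isometry_extends (f : homeo W W) : metric_isometry f ->
  exists F : homeo (bordification w0) (bordification w0), extends_by f F.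
Proof.
move=> fi; have fi' : metric_isometry (homeo_inv f).
  by move=> x y; rewrite -fi !homeo_invK.
have [F [fF _]] := bordification_homeo gW cW rW
  (isometry_boundaryK fi fi' (homeoK f)) (isometry_boundaryK fi' fi (homeo_invK f))
  (fun xi => @isometry_boundary_limit _ fi xi)
  (fun xi => @isometry_boundary_limit _ fi' xi).
by exists F.
Qed.

End Isometry.

(** Surjectivity of [h1] and its inverse come from [h]. *)
Lemma factor_isometry_homeo (R : realType) (X Y : metricType R) (y0 : Y)
    (h : homeo (l2prod X Y) (l2prod X Y)) (h1 : X -> X) (h2 : homeo Y Y) :
  (forall x y, h (x, y) = (h1 x, h2 y)) -> metric_isometry h1 ->
  exists f1 : homeo X X, forall x, f1 x = h1 x.
Proof.
move=> hE iso; pose k x := (homeo_inv h (x, y0)).1.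
have K : cancel h1 k.
  move=> x; rewrite /k; have -> : (h1 x, y0) = h (x, homeo_inv h2 y0).
    by rewrite hE homeo_invK.
  by rewrite homeoK.
have K' : cancel k h1.
  move=> x; have := homeo_invK h (x, y0).
  by rewrite /k; case: (homeo_inv h (x, y0)) => u v; rewrite hE => -[].
have ck : metric_isometry k by move=> x y; rewrite -iso !K'.
have cont (f : X -> X) : metric_isometry f -> continuous f.
  by move=> fi; apply/metric_continuousP => x e e0; exists e => // y; rewrite fi.
by exists (Homeo K K' (cont _ iso) (cont _ ck)).
Qed.

(** * Products *)

Section L2Segments.
Context {R : realType} {X Y : metricType R}.
Implicit Types p q u : l2prod X Y.

Lemma l2dist_sqr p q :
  mdist p q ^+ 2 = mdist p.1 q.1 ^+ 2 + mdist p.2 q.2 ^+ 2.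
Proof. by rewrite l2distE sqr_sqrtr// addr_ge0// sqr_ge0. Qed.

(** Equality in Minkowski's inequality: the coordinates of a geodesic of a
    product divide the segments of the factors in the same ratio. *)
Lemma at_frac_l2P (s : R) p q u : 0 <= s -> s <= 1 ->
  at_frac s p q u <-> at_frac s p.1 q.1 u.1 /\ at_frac s p.2 q.2 u.2.
Proof.
move=> s0 s1; rewrite /at_frac.
have D2 := l2dist_sqr p q; have pu2 := l2dist_sqr p u; have uq2 := l2dist_sqr u q.
split=> [[pu uq]|[[a1 c1] [a2 c2]]]; last first.
  split; apply/eqP.
    rewrite -(@eqrXn2 _ 2)// ?mulr_ge0 ?mdist_ge0//.
    by rewrite pu2 a1 a2 !exprMn D2 mulrDr.
  rewrite -(@eqrXn2 _ 2)// ?mulr_ge0 ?mdist_ge0// ?subr_ge0//.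
  by rewrite uq2 c1 c2 !exprMn D2 mulrDr.
have A1 := metric_triangle p.1 u.1 q.1; have A2 := metric_triangle p.2 u.2 q.2.
rewrite pu exprMn D2 in pu2; rewrite uq exprMn D2 in uq2.
have := mdist_ge0 p.1 u.1; have := mdist_ge0 u.1 q.1; have := mdist_ge0 p.1 q.1.
have := mdist_ge0 p.2 u.2; have := mdist_ge0 u.2 q.2; have := mdist_ge0 p.2 q.2.
move: A1 A2 pu2 uq2 {D2 pu uq}.
move: (mdist p.1 u.1) (mdist u.1 q.1) (mdist p.1 q.1) => a c A.
move: (mdist p.2 u.2) (mdist u.2 q.2) (mdist p.2 q.2) => b d B.
move=> Aac Bbd E1 E2 B0 d0 b0 A0 c0 a0.
have A2 : A ^+ 2 <= (a + c) ^+ 2 by rewrite ler_pXn2r// nnegrE addr_ge0.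
have B2 : B ^+ 2 <= (b + d) ^+ 2 by rewrite ler_pXn2r// nnegrE addr_ge0.
have t0 : 0 <= s * (1 - s) by rewrite mulr_ge0// subr_ge0.
(* A sum of nonnegative terms, vanishing by the two length equations: the first
   two vanish by equality in Cauchy-Schwarz, the others by equality in the two
   triangle inequalities. *)
have par : ((1 - s) * a - s * c) ^+ 2 + ((1 - s) * b - s * d) ^+ 2 +
    s * (1 - s) * ((a + c) ^+ 2 - A ^+ 2) +
    s * (1 - s) * ((b + d) ^+ 2 - B ^+ 2) = 0.
  transitivity ((1 - s) * (a ^+ 2 + b ^+ 2) + s * (c ^+ 2 + d ^+ 2)
     - s * (1 - s) * (A ^+ 2 + B ^+ 2)); first by ring.
  by rewrite -E1 -E2; ring.
have x1 := sqr_ge0 ((1 - s) * a - s * c); have x2 := sqr_ge0 ((1 - s) * b - s * d).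
have x3 : 0 <= s * (1 - s) * ((a + c) ^+ 2 - A ^+ 2) by rewrite mulr_ge0// subr_ge0.
have x4 : 0 <= s * (1 - s) * ((b + d) ^+ 2 - B ^+ 2) by rewrite mulr_ge0// subr_ge0.
have /eqP : ((1 - s) * a - s * c) ^+ 2 = 0 by lra.
have /eqP : ((1 - s) * b - s * d) ^+ 2 = 0 by lra.
rewrite !sqrf_eq0 !subr_eq0 => /eqP eb /eqP ea.
have sq : A ^+ 2 + B ^+ 2 = (a + c) ^+ 2 + (b + d) ^+ 2.
  have e1 : a = s * (a + c) by lra.
  have e2 : b = s * (b + d) by lra.
  have [s0'|sn] := eqVneq s 0.
    have a00 : a = 0 by rewrite e1 s0' mul0r.
    have b00 : b = 0 by rewrite e2 s0' mul0r.
    by move: E2; rewrite s0' subr0 expr1n mul1r a00 b00 !add0r.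
  have s2 : s ^+ 2 != 0 by rewrite expf_neq0.
  by apply: (mulfI s2); rewrite E1 mulrDr -!exprMn -e1 -e2.
have AE : A = a + c.
  by apply/eqP; rewrite -(@eqrXn2 _ 2)// ?addr_ge0//; apply/eqP; lra.
have BE : B = b + d.
  by apply/eqP; rewrite -(@eqrXn2 _ 2)// ?addr_ge0//; apply/eqP; lra.
by rewrite AE BE; split; split; lra.
Qed.

Lemma cosine_law_l2 : cosine_law X -> cosine_law Y -> cosine_law (l2prod X Y).
Proof.
move=> cX cY p q r u v s t s0 s1 t0 t1.
move=> /(at_frac_l2P _ _ _ s0 s1)[u1 u2] /(at_frac_l2P _ _ _ t0 t1)[v1 v2].
have := lerD (cX _ _ _ _ _ _ _ s0 s1 t0 t1 u1 v1) (cY _ _ _ _ _ _ _ s0 s1 t0 t1 u2 v2).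
rewrite !l2dist_sqr => /le_trans; apply.
by rewrite le_eqVlt; apply/orP; left; apply/eqP; ring.
Qed.

Lemma geodesic_space_l2 :
  geodesic_space X -> geodesic_space Y -> geodesic_space (l2prod X Y).
Proof.
move=> gX gY p q; have [g1 [g10 g1d g1i]] := gX p.1 q.1.
have [g2 [g20 g2d g2i]] := gY p.2 q.2.
have [pq|npq] := eqVneq p q.
  exists (fun=> p); split=> //.
  move=> s t; rewrite pq mdistxx => s0 t0.
  have := rval_ge0 s; have := rval_ge0 t => t0' s0'.
  by have -> : rval s - rval t = 0; [lra|rewrite normr0].
have D0 : 0 < mdist p q by rewrite mdist_gt0.
pose k1 := mdist p.1 q.1 / mdist p q; pose k2 := mdist p.2 q.2 / mdist p q.
have k10 : 0 <= k1 by rewrite divr_ge0// mdist_ge0.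
have k20 : 0 <= k2 by rewrite divr_ge0// mdist_ge0.
have kk : k1 ^+ 2 + k2 ^+ 2 = 1.
  by rewrite !exprMn exprVn -mulrDl -l2dist_sqr divff// expf_neq0// gt_eqF.
have k1D : k1 * mdist p q = mdist p.1 q.1 by rewrite divfK// gt_eqF.
have k2D : k2 * mdist p q = mdist p.2 q.2 by rewrite divfK// gt_eqF.
clearbody k1 k2.
exists (fun t => (g1 (Rplus_mul (mkRplus k10) t), g2 (Rplus_mul (mkRplus k20) t))).
split.
- have z (k : Rplus R) : Rplus_mul k Rplus0 = Rplus0.
    by apply: rval_inj; rewrite rvalM mulr0.
  by rewrite !z g10 g20; case: (p).
- have -> : Rplus_mul (mkRplus k10) (rdist p q) = rdist p.1 q.1.
    by apply: rval_inj; rewrite rvalM !rvalE.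
  have -> : Rplus_mul (mkRplus k20) (rdist p q) = rdist p.2 q.2.
    by apply: rval_inj; rewrite rvalM !rvalE.
  by rewrite g1d g2d; case: (q).
- move=> s t sD tD; rewrite l2distE /= g1i ?g2i ?rvalM ?rvalE -?k1D -?k2D ?ler_wpM2l//.
  rewrite -!mulrBr !normrM !exprMn !real_normK ?num_real// -mulrDl kk mul1r.
  exact: sqrtr_sqr.
Qed.

End L2Segments.

(** * The coordinates of a convergent filter in a product *)

Section Factor.
Context {R : realType} {T : Type} (F : set_system T) {FF : Filter F}.
Context {W : metricType R} (w0 : W).
Implicit Types (w : T -> W) (n : T -> R) (p : Rplus R -> W).
Hypotheses (gW : geodesic_space W) (cW : cosine_law W).

(** What convergence of [z = (w, _)] to the end of a ray with coordinate path
    [p] means for the coordinate [w], where [n] is the distance of [z] to the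
    base point: the coordinate at distance [r] of the geodesic to [z] divides
    the segment from [w0] to [w] in the ratio [r / n]. *)
Definition frac_cvg w n p := forall r e : R, 0 < r -> 0 < e ->
  \forall t \near F, r < n t /\
    exists u, at_frac (r / n t) w0 (w t) u /\ mdist u (p (Rpos r)) < e.

Definition has_speed (a : Rplus R) p :=
  p Rplus0 = w0 /\ forall s t, mdist (p s) (p t) = rval a * `|rval s - rval t|.

Definition diverges n := forall M : R, \forall t \near F, M < n t.

Definition ratio_cvg (m n : T -> R) (a : R) := forall e, 0 < e ->
  \forall t \near F, `|m t - a * n t| <= e * n t.

Lemma has_speed0 a p r : has_speed a p -> 0 <= r ->
  mdist w0 (p (Rpos r)) = rval a * r.
Proof.
by move=> [p0 pa] r0; rewrite -p0 pa rvalE sub0r normrN RposE// ger0_norm.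
Qed.

Lemma frac_cvg_diverges w n p : frac_cvg w n p -> diverges n.
Proof.
move=> H M; have M0 : 0 < `|M| + 1 by rewrite ltr_pwDr.
have := H _ _ M0 ltr01; apply: filterS => t [Mn _].
by have := ler_norm M; lra.
Qed.

Lemma frac_cvg_ratio w n p a : has_speed a p -> frac_cvg w n p ->
  ratio_cvg (fun t => mdist w0 (w t)) n (rval a).
Proof.
move=> pa H e e0; have := H _ _ ltr01 e0; apply: filterS => t [n1 [u [[wu _] ue]]].
have n0 : 0 < n t by lra.
have p1 := has_speed0 pa ler01; rewrite mulr1 in p1.
have h : `|mdist w0 u - rval a| <= e.
  have := metric_triangle w0 u (p (Rpos 1)); have := metric_triangle w0 (p (Rpos 1)) u.
  rewrite p1 (metric_sym (p _) u) ler_norml; lra.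
have -> : mdist w0 (w t) = mdist w0 u * n t by rewrite wu; field; rewrite gt_eqF.
by rewrite -mulrBl normrM (gtr0_norm n0) ler_pM2r.
Qed.

Lemma same_segment (p q u v : W) (s t : R) : 0 <= s -> s <= mdist p q ->
  0 <= t -> t <= mdist p q -> at_dist s p q u -> at_dist t p q v ->
  mdist u v = `|s - t|.
Proof.
move=> s0 sd t0 td su tv; have [g gg] := gW p q; have [_ _ gi] := gg.
have su' := @geodesic_at_dist _ _ g p q (Rpos s) gg.
have tv' := @geodesic_at_dist _ _ g p q (Rpos t) gg.
rewrite !RposE// in su' tv'.
rewrite (at_dist_uniq cW s0 sd su (su' sd)) (at_dist_uniq cW t0 td tv (tv' td)).
by rewrite gi !RposE.
Qed.

Lemma at_frac_dist (s : R) (p q u : W) : at_frac s p q u ->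
  at_dist (s * mdist p q) p q u.
Proof. by move=> [pu uq]; split=> //; rewrite uq mulrBl mul1r. Qed.

(** A coordinate moving at positive speed converges to its own end. *)
Lemma frac_cvg_cone w n p (a : Rplus R) (c : ray W) :
  (forall t, mdist w0 (w t) <= n t) ->
  0 < rval a -> c Rplus0 = w0 -> (forall t, p t = c (Rplus_mul a t)) ->
  frac_cvg w n p -> cone_cvg w0 (w @ F) c.
Proof.
move=> wn a0 c0 pc H s e s0 e0.
have pa : has_speed a p.
  split; first by rewrite pc -c0; congr (c _); apply: rval_inj; rewrite rvalM mulr0.
  by move=> x y; rewrite !pc rayP !rvalM -mulrBr normrM gtr0_norm.
have r0 : 0 < rval s / rval a by rewrite divr_gt0.
have e2 : 0 < e / 2 by rewrite divr_gt0.
have a2 : 0 < rval a / 2 by rewrite divr_gt0.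
have cs : p (Rpos (rval s / rval a)) = c s.
  rewrite pc; congr (c _); apply: rval_inj.
  by rewrite rvalM RposE ?(ltW r0)// mulrC divfK// gt_eqF.
pose FI := @filterI _ F FF.
have := FI _ _ (frac_cvg_ratio pa H a2)
  (FI _ _ (H _ _ r0 e2) (frac_cvg_diverges H (2 * rval s / rval a))).
apply: (@filterS _ F) => t [] /=; rewrite ler_norml => /andP[h1 h2].
rewrite cs => -[[rn [u [wu ue]]] sn].
have n0 : 0 < n t by lra.
have sw : rval s < mdist w0 (w t).
  by move: sn; rewrite ltr_pdivrMr//; lra.
apply/(cone_nbhdP _ gW); split=> //; have [g gg] := gW w0 (w t).
have vs := geodesic_at_dist gg (ltW sw); exists (g s); split=> //.
have ud := at_frac_dist wu.
have f0 : 0 <= rval s / rval a / n t * mdist w0 (w t).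
  by apply: mulr_ge0; [apply: divr_ge0; exact: ltW|exact: mdist_ge0].
have f1 : rval s / rval a / n t * mdist w0 (w t) <= mdist w0 (w t).
  rewrite -[leRHS]mul1r ler_wpM2r ?mdist_ge0//.
  by rewrite ler_pdivrMr// mul1r ltW.
have uv := same_segment f0 f1 (ltW s0) (ltW sw) ud vs.
have cl : mdist w0 (c s) = rval s.
  by rewrite -c0 rayP rvalE sub0r normrN gtr0_norm.
have := metric_triangle w0 u (c s); have := metric_triangle w0 (c s) u.
have := metric_triangle (g s) u (c s).
rewrite (metric_sym (c s) u) (metric_sym (g s) u) uv cl ud.1 => h3 h4 h5.
apply: le_lt_trans h3 _.
suff : `|rval s / rval a / n t * mdist w0 (w t) - rval s| <= mdist u (c s) by lra.
rewrite ler_norml; lra.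
Qed.

(** Conversely convergence of a coordinate in its factor, together with its share
    of the total distance, determines its [frac_cvg]; when the share is
    negligible no convergence in the factor is needed. *)
Lemma cone_cvg_frac w n p (a : Rplus R) :
  (forall t, mdist w0 (w t) <= n t) -> diverges n ->
  ratio_cvg (fun t => mdist w0 (w t)) n (rval a) -> has_speed a p ->
  (0 < rval a -> exists c : ray W, (forall t, p t = c (Rplus_mul a t)) /\
     cone_cvg w0 (w @ F) c) ->
  frac_cvg w n p.
Proof.
move=> wn dn rn pa cc r e r0 e0.
pose FI := @filterI _ F FF.
have d0 : 0 < e / 2 / r by rewrite !divr_gt0.
have pick t : r < n t -> `|mdist w0 (w t) - rval a * n t| <= e / 2 / r * n t ->
    exists u, [/\ at_frac (r / n t) w0 (w t) u,
      mdist w0 u <= mdist w0 (w t) &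
      `|mdist w0 u - rval a * r| <= e / 2].
  move=> rnt ht; have n0 : 0 < n t by lra.
  pose l := r / n t * mdist w0 (w t).
  have l0 : 0 <= l by apply: mulr_ge0; [apply: divr_ge0; exact: ltW|exact: mdist_ge0].
  have l1 : l <= mdist w0 (w t).
    rewrite -[leRHS]mul1r ler_wpM2r ?mdist_ge0//.
    by rewrite ler_pdivrMr// mul1r ltW.
  have [g gg] := gW w0 (w t); exists (g (Rpos l)).
  have := @geodesic_at_dist _ _ g w0 (w t) (Rpos l) gg.
  rewrite RposE// => /(_ l1)[gl gl']; split.
  - by split; rewrite ?gl ?gl' ?mulrBl ?mul1r.
  - by rewrite gl.
  - rewrite gl /l; have -> : r / n t * mdist w0 (w t) - rval a * r =
      (mdist w0 (w t) - rval a * n t) * (r / n t) by field; rewrite gt_eqF.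
    have rn0 : 0 < r / n t by rewrite divr_gt0.
    rewrite normrM (gtr0_norm rn0); apply: le_trans (ler_wpM2r (ltW rn0) ht) _.
    rewrite le_eqVlt; apply/orP; left; apply/eqP; field.
    by rewrite !gt_eqF.
have [a0|a0] := ltP 0 (rval a); last first.
  have az : rval a = 0 by apply: le_anti; rewrite a0 rval_ge0.
  have := FI _ _ (dn r) (rn _ d0); apply: (@filterS _ F) => t [/= rnt ht]; split=> //.
  have [u [wu _ ud]] := pick t rnt ht; exists u; split=> //.
  have -> : p (Rpos r) = w0.
    apply/esym; apply: mdist_positivity.
    by rewrite (has_speed0 pa (ltW r0)) az mul0r.
  move: ud; rewrite az mul0r subr0 ger0_norm ?mdist_ge0// metric_sym; lra.
have [c [pc Fc]] := cc a0.
have s0 : 0 < rval a * r by rewrite mulr_gt0.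
pose s := Rpos (rval a * r); have sE : rval s = rval a * r by rewrite RposE// ltW.
have cs : p (Rpos r) = c s.
  by rewrite pc; congr (c _); apply: rval_inj; rewrite rvalM RposE ?sE// ltW.
have sp : 0 < rval s by rewrite sE.
have e2 : 0 < e / 2 by rewrite divr_gt0.
have := FI _ _ (Fc s _ sp e2) (FI _ _ (dn r) (rn _ d0)).
apply: (@filterS _ F) => t [] /= /(cone_nbhdP _ gW)[sw [v [vs ve]]] [rnt ht].
split=> //.
have [u [wu uw ud]] := pick t rnt ht; exists u; split=> //.
have uv := same_segment (mdist_ge0 _ _) uw (ltW sp) (ltW sw)
  _ vs.
rewrite sE in uv; have := metric_triangle u v (c s).
rewrite cs uv; first by lra.
by have [h1 h2] := at_frac_dist wu; split; rewrite // h2 h1.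
Qed.

End Factor.

Section AsymptoticNorm.
Context {R : realType} {W : metricType R} (w0 : W).

(** [f] preserves the distance to [w0] up to a factor tending to [1], and is
    bounded on bounded sets. The additive constant merges both conditions in
    an estimate valid on all of [W]. *)
Definition asym_norm (f : W -> W) := forall e : R, 0 < e -> exists M : R,
  forall w, `|mdist w0 (f w) - mdist w0 w| <= e * mdist w0 w + M.

Lemma isometry_asym_norm (f : W -> W) :
  metric_isometry f -> asym_norm f.
Proof.
move=> fi e e0; exists (mdist w0 (f w0)) => w.
have := mulr_ge0 (ltW e0) (mdist_ge0 w0 w).
have := metric_triangle w0 (f w0) (f w); have := metric_triangle (f w0) w0 (f w).
rewrite fi (metric_sym (f w0) w0) ler_norml; lra.
Qed.

(** For a deviation [d <= 1 / 2] the estimate for [f] bounds [mdist w0 (f' w)] by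
    twice [mdist w0 w] plus a constant, so it can be read from the other side. *)
Lemma asym_norm_inv (f f' : W -> W) : cancel f' f -> asym_norm f -> asym_norm f'.
Proof.
move=> fK fa e e0.
pose d := Num.min (e / 2) (1 / 2).
have d0 : 0 < d by rewrite lt_min !divr_gt0.
have [M HM] := fa d d0; exists (`|M| + e * `|M|) => w.
have := HM (f' w); rewrite fK distrC => h.
have := mdist_ge0 w0 (f' w); have := mdist_ge0 w0 w; have := ler_norm M.
have : d <= e / 2 by rewrite /d ge_min lexx.
have : d <= 1 / 2 by rewrite /d ge_min lexx orbT.
move: h; rewrite !ler_norml => /andP[h1 h2].
move: (mdist w0 w) (mdist w0 (f' w)) => a b in h1 h2 * => d1 d2 M0 a0 b0.
have k1 : d * b <= 1 / 2 * b by rewrite ler_wpM2r.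
have k2 : d * b <= e / 2 * b by rewrite ler_wpM2r.
have k3 : b <= 2 * a + 2 * `|M| by lra.
have k4 : e / 2 * b <= e / 2 * (2 * a + 2 * `|M|) by rewrite ler_wpM2l// divr_ge0// ltW.
have k5 : e / 2 * (2 * a + 2 * `|M|) = e * a + e * `|M| by field.
lra.
Qed.

Lemma asym_norm_ratio {T : Type} (F : set_system T) {FF : Filter F}
    (f : W -> W) (w : T -> W) (n : T -> R) :
  asym_norm f -> diverges F n -> (forall t, mdist w0 (w t) <= n t) ->
  forall e, 0 < e ->
  \forall t \near F, `|mdist w0 (f (w t)) - mdist w0 (w t)| <= e * n t.
Proof.
move=> fa dn wn e e0; have e2 : 0 < e / 2 by rewrite divr_gt0.
have [M HM] := fa _ e2; have := dn (2 * M / e).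
apply: (@filterS _ F) => t; rewrite ltr_pdivrMr// => h.
apply: le_trans (HM _) _; have := ler_wpM2l (ltW e2) (wn t); lra.
Qed.

End AsymptoticNorm.

Lemma sqrt_diff (R : realType) (a b c d : R) : 0 <= a -> 0 <= b -> 0 <= c -> 0 <= d ->
  `|Num.sqrt (a ^+ 2 + b ^+ 2) - Num.sqrt (c ^+ 2 + d ^+ 2)| <= `|a - c| + `|b - d|.
Proof.
have half (x y z t : R) : 0 <= x -> 0 <= y -> 0 <= z -> 0 <= t ->
    Num.sqrt (x ^+ 2 + y ^+ 2) <= Num.sqrt (z ^+ 2 + t ^+ 2) + (`|x - z| + `|y - t|).
  move=> x0 y0 z0 t0.
  have h : Num.sqrt (`|x - z| ^+ 2 + `|y - t| ^+ 2) <= `|x - z| + `|y - t|.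
    have -> : `|x - z| + `|y - t| = Num.sqrt ((`|x - z| + `|y - t|) ^+ 2).
      by rewrite sqrtr_sqr [RHS]ger0_norm// addr_ge0.
    by rewrite ler_wsqrtr// [leRHS]sqrrD -addrA lerD2l lerDr mulrn_wge0// mulr_ge0.
  apply: le_trans (lerD (lexx _) h).
  apply: le_trans (l2_minkowski _ _ _ _) => //.
  have le (u v : R) : 0 <= u -> u ^+ 2 <= (v + `|u - v|) ^+ 2.
    move=> u0; have := ler_norm (u - v) => uv.
    by rewrite lerXn2r// ?nnegrE; lra.
  by rewrite ler_wsqrtr// lerD// le.
move=> a0 b0 c0 d0; have := half a b c d a0 b0 c0 d0; have := half c d a b c0 d0 a0 b0.
by rewrite (distrC c a) (distrC d b) ler_norml; lra.
Qed.

Section ProductLimit.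
Context {R : realType} {X Y : metricType R} (x0 : X) (y0 : Y).
Local Notation z0 := ((x0, y0) : l2prod X Y).
Hypotheses (gX : geodesic_space X) (cX : cosine_law X)
  (gY : geodesic_space Y) (cY : cosine_law Y).

Lemma cone_cvg_l2P (F : set_system (l2prod X Y)) {FF : Filter F}
    (c : ray (l2prod X Y)) : c Rplus0 = z0 ->
  cone_cvg z0 F c <->
  frac_cvg F x0 fst (mdist z0) (fun t => (c t).1) /\
  frac_cvg F y0 snd (mdist z0) (fun t => (c t).2).
Proof.
move=> c0; have gXY := geodesic_space_l2 gX gY.
have frac (r : R) w : 0 < r -> r < mdist z0 w -> 0 <= r / mdist z0 w <= 1.
  move=> r0 rw; have w0 := lt_trans r0 rw.
  by rewrite divr_ge0 ?ler_pdivrMr ?mul1r ?(ltW rw) ?(ltW r0) ?(ltW w0).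
split=> [Fc|[F1 F2] r e r0 e0].
  have key (r e : R) : 0 < r -> 0 < e -> F [set w | r < mdist z0 w /\
      exists u : l2prod X Y,
      [/\ at_frac (r / mdist z0 w) x0 w.1 u.1, at_frac (r / mdist z0 w) y0 w.2 u.2 &
      mdist u (c (Rpos r)) < e]].
    move=> r0 e0; have rr : 0 < rval (Rpos r) by rewrite RposE ?ltW.
    have := Fc _ _ rr e0; apply: (@filterS _ F) => w /= /(cone_nbhdP _ gXY).
    rewrite RposE ?(ltW r0)// => -[rw [u [ru ue]]]; split=> //; exists u.
    have w0 := lt_trans r0 rw; have /andP[f0 f1] := frac r w r0 rw.
    by move/(at_distE _ _ w0) : ru => /(at_frac_l2P _ _ _ f0 f1)[].
  split=> r e r0 e0; have := key r e r0 e0;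
    apply: (@filterS _ F) => w [rw [u [u1 u2 ue]]]; split=> //.
    by exists u.1; split=> //; exact: le_lt_trans (mdist_fst _ _) ue.
  by exists u.2; split=> //; exact: le_lt_trans (mdist_snd _ _) ue.
have e2 : 0 < e / 2 by rewrite divr_gt0.
have := @filterI _ F FF _ _ (F1 _ _ r0 e2) (F2 _ _ r0 e2).
apply: (@filterS _ F) => w [[rw [u1 [wu1 ue1]]] [_ [u2 [wu2 ue2]]]].
have w0 := lt_trans r0 rw; have /andP[f0 f1] := frac _ w r0 rw.
apply/(cone_nbhdP _ gXY); split=> //; exists (u1, u2); split.
  by apply/(at_distE _ _ w0)/(at_frac_l2P _ _ _ f0 f1).
have rr : Rpos (rval r) = r by apply: rval_inj; rewrite RposE// ltW.
rewrite rr in ue1 ue2; apply: le_lt_trans (mdist_sum _ _) _ => /=; lra.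
Qed.

(** [p] and [p'] are the coordinate paths, of equal speed [a], of a ray of a
    product and of its image. A coordinate of speed zero contributes no
    boundary point, and its limit is then unconstrained. *)
Definition path_limit (W : metricType R) (w0 : W) (f : W -> W) (a : Rplus R)
    (p p' : Rplus R -> W) :=
  [/\ has_speed w0 a p, has_speed w0 a p' & 0 < rval a ->
    exists c c' : ray W, [/\ c Rplus0 = w0, c' Rplus0 = w0,
      forall t, p t = c (Rplus_mul a t), forall t, p' t = c' (Rplus_mul a t) &
      boundary_limit w0 f (\pi_(boundary W) c) (\pi_(boundary W) c')]].

(** The share of a coordinate in the total distance is preserved because [f] and
    the total distance are both perturbed by a factor tending to [1]; if the
    share is positive, the coordinate converges in its factor, where the
    boundary behaviour of [f] applies. *)
Lemma path_limit_factor (W : metricType R) (w0 : W) (f : W -> W) (a : Rplus R)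
    (p p' : Rplus R -> W) (T : Type) (F : set_system T) {FF : Filter F}
    (w : T -> W) (n n' : T -> R) :
  geodesic_space W -> cosine_law W -> asym_norm w0 f ->
  (forall t, mdist w0 (w t) <= n t) -> (forall t, mdist w0 (f (w t)) <= n' t) ->
  ratio_cvg F n' n 1 ->
  path_limit w0 f a p p' -> frac_cvg F w0 w n p -> frac_cvg F w0 (f \o w) n' p'.
Proof.
move=> gW cW fa wn wn' nn' [pa pa' cc] H; pose FI := @filterI _ F FF.
have dn : diverges F n by exact: frac_cvg_diverges H.
have half : (0 : R) < 1 / 2 by rewrite divr_gt0.
have dn' : diverges F n'.
  move=> M; have := FI _ _ (nn' _ half) (FI _ _ (dn (2 * M)) (dn 0)).
  by apply: (@filterS _ F) => t []; rewrite ler_norml => /andP[h1 h2] [h3 h4]; lra.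
apply: (cone_cvg_frac gW cW (a := a)) => // [e e0|a0].
  pose K := 4 * (1 + rval a).
  have a0 := rval_ge0 a.
  have K0 : 0 < K by rewrite /K; lra.
  have d0 : 0 < e / K by rewrite divr_gt0.
  have := FI _ _
    (FI _ _ (frac_cvg_ratio (FF := FF) pa H d0)
       (asym_norm_ratio (FF := FF) fa dn wn d0))
    (FI _ _ (FI _ _ (nn' _ d0) (nn' _ half)) (dn 0)).
  apply: (@filterS _ F) => t [[]]; rewrite /= !ler_norml.
  move=> /andP[h1 h2] /andP[h3 h4] [[/andP[h5 h6] /andP[h7 h8]] h9].
  have nb : n t <= 2 * n' t by lra.
  have dK : e / K * n t * (2 + rval a) <= e * n' t.
    have x1 : e / K * n t <= e / K * (2 * n' t) by rewrite ler_pM2l.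
    have x2 : e / K * n t * (2 + rval a) <= e / K * (2 * n' t) * (2 + rval a).
      by rewrite ler_wpM2r// addr_ge0.
    apply: le_trans x2 _; have n'0 : 0 <= n' t by lra.
    have -> : e / K * (2 * n' t) * (2 + rval a) = e * n' t * (2 * (2 + rval a) / K).
      by rewrite mulrAC [in RHS]mulrAC; field; rewrite gt_eqF.
    rewrite -[leRHS]mulr1 ler_wpM2l ?mulr_ge0 ?(ltW e0)//.
    by rewrite ler_pdivrMr// mul1r /K; lra.
  have y1 : rval a * (n' t - 1 * n t) <= rval a * (e / K * n t) by rewrite ler_wpM2l.
  have y2 : rval a * (- (e / K * n t)) <= rval a * (n' t - 1 * n t).
    by rewrite ler_wpM2l.
  lra.
have [c [c' [c0 c'0 pc pc' lim]]] := cc a0; exists c'; split=> //.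
have /(cvg_inBdP gW cW (F := w @ F) c0) :=
  frac_cvg_cone (FF := FF) gW cW wn a0 c0 pc H.
by move=> /(lim (w @ F)) /(cvg_inBdP gW cW (F := f @ (w @ F)) c'0).
Qed.

(** Asymptotic preservation of norms in both factors keeps the limiting slope, and
    the boundary maps of the factors move the two ends of the join line. *)
Lemma product_cone_cvg (f1 : X -> X) (f2 : Y -> Y) (F : set_system (l2prod X Y))
    {FF : Filter F} (c c' : ray (l2prod X Y)) (a b : Rplus R) :
  asym_norm x0 f1 -> asym_norm y0 f2 -> c Rplus0 = z0 -> c' Rplus0 = z0 ->
  path_limit x0 f1 a (fun t => (c t).1) (fun t => (c' t).1) ->
  path_limit y0 f2 b (fun t => (c t).2) (fun t => (c' t).2) ->
  cone_cvg z0 F c ->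
  cone_cvg z0 ((fun w : l2prod X Y => (f1 w.1, f2 w.2) : l2prod X Y) @ F) c'.
Proof.
move=> fa1 fa2 c0 c'0 lim1 lim2 /(cone_cvg_l2P c0)[F1 F2].
set f := fun w : l2prod X Y => _.
pose n := mdist z0; pose n' w := mdist z0 (f w).
have n1 w : mdist x0 w.1 <= n w by exact: (mdist_fst z0 w).
have n2 w : mdist y0 w.2 <= n w by exact: (mdist_snd z0 w).
have n1' w : mdist x0 (f1 w.1) <= n' w by exact: (mdist_fst z0 (f w)).
have n2' w : mdist y0 (f2 w.2) <= n' w by exact: (mdist_snd z0 (f w)).
have dn : diverges F n by exact: frac_cvg_diverges F1.
have nn' : ratio_cvg F n' n 1.
  move=> e e0; have e2 : 0 < e / 2 by rewrite divr_gt0.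
  have := @filterI _ F FF _ _ 
    (asym_norm_ratio (FF := FF) fa1 dn n1 e2)
    (asym_norm_ratio (FF := FF) fa2 dn n2 e2).
  apply: (@filterS _ F) => w [/= h1 h2]; rewrite mul1r /n' /n.
  suff : `|mdist z0 (f w) - mdist z0 w| <=
    `|mdist x0 (f1 w.1) - mdist x0 w.1| + `|mdist y0 (f2 w.2) - mdist y0 w.2|.
    by move=> /le_trans; apply; rewrite /n in h1 h2; lra.
  by rewrite !(l2distE z0) /=; apply: sqrt_diff; exact: mdist_ge0.
have G1 := path_limit_factor (FF := FF) gX cX fa1 n1 n1' nn' lim1 F1.
have G2 := path_limit_factor (FF := FF) gY cY fa2 n2 n2' nn' lim2 F2.
by apply/(cone_cvg_l2P (F := f @ F) c'0); split=> r e r0 e0;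
  [exact: (G1 r e r0 e0)|exact: (G2 r e r0 e0)].
Qed.

End ProductLimit.

(** * Extension to the join of the boundaries *)

Section JoinExtension.
Context {R : realType} {X Y : metricType R} (x0 : X) (y0 : Y).
Local Notation z0 := ((x0, y0) : l2prod X Y).
Hypotheses (pX : proper_space X) (gX : geodesic_space X) (cX : cosine_law X)
  (pY : proper_space Y) (gY : geodesic_space Y) (cY : cosine_law Y).

Lemma has_speed_ray (W : metricType R) (w0 : W) (c : ray W) (a : Rplus R)
    (p : Rplus R -> W) :
  c Rplus0 = w0 -> (forall t, p t = c (Rplus_mul a t)) -> has_speed w0 a p.
Proof.
move=> c0 pc; split.
  by rewrite pc -c0; congr (c _); apply: rval_inj; rewrite rvalM mulr0.
by move=> s t; rewrite !pc rayP !rvalM -mulrBr normrM ger0_norm// rval_ge0.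
Qed.

Lemma path_limit_ray (W : metricType R) (w0 : W) (f : W -> W) (c c' : ray W)
    (a : Rplus R) (p p' : Rplus R -> W) : c Rplus0 = w0 -> c' Rplus0 = w0 ->
  (forall t, p t = c (Rplus_mul a t)) -> (forall t, p' t = c' (Rplus_mul a t)) ->
  boundary_limit w0 f (\pi_(boundary W) c) (\pi_(boundary W) c') ->
  path_limit w0 f a p p'.
Proof.
move=> c0 c'0 pc pc' lim; split; [exact: has_speed_ray pc|exact: has_speed_ray pc'|].
by move=> _; exists c, c'.
Qed.

Lemma path_limit_const (W : metricType R) (w0 : W) (f : W -> W) :
  path_limit w0 f Rplus0 (fun=> w0) (fun=> w0).
Proof.
have s : has_speed w0 (@Rplus0 R) (fun=> w0).
  by split=> // s t; rewrite mdistxx rvalE mul0r.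
by split=> //; rewrite rvalE ltxx.
Qed.

Lemma repr_bounded (W : metricType R) (c : ray W) xi : \pi_(boundary W) c = xi ->
  exists K : R, forall t, mdist (c t) (repr xi t) <= K.
Proof.
move=> cxi; have := asymptotic_repr c; rewrite cxi => -[K HK].
by exists K => t; rewrite metric_sym.
Qed.

Let rX (c : ray X) := asymptotic_ray_from x0 c pX cX gX.
Let rY (c : ray Y) := asymptotic_ray_from y0 c pY cY gY.

(** The representatives [repr xi] in [prejoin_boundary] may start anywhere; rays
    from the base points asymptotic to them give the same points at infinity,
    with coordinate speeds read off from the slope. *)
Lemma prejoin_rays (f1 : X -> X) (f2 : Y -> Y)
    (d1 : cone_boundary x0 -> cone_boundary x0)
    (d2 : cone_boundary y0 -> cone_boundary y0) :
  (forall xi, boundary_limit x0 f1 xi (d1 xi)) ->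
  (forall eta, boundary_limit y0 f2 eta (d2 eta)) ->
  forall z : prejoin (cone_boundary x0) (cone_boundary y0),
  exists (c c' : ray (l2prod X Y)) (a b : Rplus R),
  [/\ c Rplus0 = z0 /\ c' Rplus0 = z0,
      \pi_(boundary (l2prod X Y)) c = prejoin_boundary x0 y0 z,
      \pi_(boundary (l2prod X Y)) c' = prejoin_boundary x0 y0 (prejoin_map d1 d2 z),
      path_limit x0 f1 a (fun t => (c t).1) (fun t => (c' t).1) &
      path_limit y0 f2 b (fun t => (c t).2) (fun t => (c' t).2)].
Proof.
move=> lim1 lim2; pose one : Rplus R := mkRplus ler01.
have mul1 t : Rplus_mul one t = t by apply: rval_inj; rewrite rvalM rvalE mul1r.
have mul0 k : Rplus_mul k Rplus0 = Rplus0 :> Rplus R.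
  by apply: rval_inj; rewrite rvalM mulr0.
have still (W : metricType R) (w : W) :
    exists K : R, forall t : Rplus R, mdist w w <= K.
  by exists 0 => t; rewrite mdistxx.
have scaled (W : metricType R) (c c' : ray W) (k : Rplus R) :
    (exists K : R, forall t, mdist (c t) (c' t) <= K) ->
    exists K : R, forall t, mdist (c (Rplus_mul k t)) (c' (Rplus_mul k t)) <= K.
  by move=> [K HK]; exists K => t.
have rayX xi := boundary_ray rX xi; have rayY eta := boundary_ray rY eta.
case=> [xi|eta|xi eta m].
- have [c [c0 cxi]] := rayX xi; have [c' [c'0 c'xi]] := rayX (d1 xi).
  exists (Ray (is_ray_left c y0)), (Ray (is_ray_left c' y0)), one, Rplus0; split.
  + by rewrite /= c0 c'0.
  + by apply: asymptotic_l2 => /=; [exact: repr_bounded|exact: still].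
  + by apply: asymptotic_l2 => /=; [exact: repr_bounded|exact: still].
  + apply: (path_limit_ray c0 c'0) => [t|t|] /=; rewrite ?mul1//.
    by rewrite cxi c'xi; exact: lim1.
  + exact: path_limit_const.
- have [c [c0 ceta]] := rayY eta; have [c' [c'0 c'eta]] := rayY (d2 eta).
  exists (Ray (is_ray_right x0 c)), (Ray (is_ray_right x0 c')), Rplus0, one; split.
  + by rewrite /= c0 c'0.
  + by apply: asymptotic_l2 => /=; [exact: still|exact: repr_bounded].
  + by apply: asymptotic_l2 => /=; [exact: still|exact: repr_bounded].
  + exact: path_limit_const.
  + apply: (path_limit_ray c0 c'0) => [t|t|] /=; rewrite ?mul1//.
    by rewrite ceta c'eta; exact: lim2.
- have [c [c0 cxi]] := rayX xi; have [c' [c'0 c'xi]] := rayX (d1 xi).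
  have [b [b0 beta]] := rayY eta; have [b' [b'0 b'eta]] := rayY (d2 eta).
  exists (Ray (is_ray_slope c b m)), (Ray (is_ray_slope c' b' m)),
    (mkRplus (slope_cos_ge0 m)), (mkRplus (slope_sin_ge0 m)); split.
  + by rewrite /= !mul0 c0 c'0 b0 b'0.
  + by apply: asymptotic_l2 => /=; apply: scaled; exact: repr_bounded.
  + by apply: asymptotic_l2 => /=; apply: scaled; exact: repr_bounded.
  + apply: (path_limit_ray c0 c'0) => [t|t|] //=.
    by rewrite cxi c'xi; exact: lim1.
  + apply: (path_limit_ray b0 b'0) => [t|t|] //=.
    by rewrite beta b'eta; exact: lim2.
Qed.

Let gXY := geodesic_space_l2 gX gY.
Let cXY := cosine_law_l2 cX cY.

Lemma prejoin_boundary_limit (f1 : X -> X) (f2 : Y -> Y)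
    (d1 : cone_boundary x0 -> cone_boundary x0)
    (d2 : cone_boundary y0 -> cone_boundary y0) :
  asym_norm x0 f1 -> asym_norm y0 f2 ->
  (forall xi, boundary_limit x0 f1 xi (d1 xi)) ->
  (forall eta, boundary_limit y0 f2 eta (d2 eta)) ->
  forall z : prejoin (cone_boundary x0) (cone_boundary y0),
  boundary_limit z0 (fun w : l2prod X Y => (f1 w.1, f2 w.2) : l2prod X Y)
    (prejoin_boundary x0 y0 z) (prejoin_boundary x0 y0 (prejoin_map d1 d2 z)).
Proof.
move=> fa1 fa2 lim1 lim2 z F FF.
have [c [c' [a [b [[c0 c'0] <- <- pl1 pl2]]]]] := prejoin_rays lim1 lim2 z.
move=> /(cvg_inBdP gXY cXY c0) Fc.
pose f (w : l2prod X Y) : l2prod X Y := (f1 w.1, f2 w.2).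
apply/(cvg_inBdP gXY cXY (F := f @ F) c'0).
exact: (product_cone_cvg gX cX gY cY fa1 fa2 c0 c'0 pl1 pl2 Fc).
Qed.

Lemma ray_from_l2 (c : ray (l2prod X Y)) : exists c' : ray (l2prod X Y),
  c' Rplus0 = z0 /\ \pi_(boundary (l2prod X Y)) c' = \pi_(boundary (l2prod X Y)) c.
Proof.
have [z zc] := join_boundary_surj x0 y0 (\pi_(boundary (l2prod X Y)) c).
have lim1 xi : boundary_limit x0 (@id X) xi (@id (cone_boundary x0) xi) by [].
have lim2 eta : boundary_limit y0 (@id Y) eta (@id (cone_boundary y0) eta) by [].
have [c' [_ [_ [_ [[c'0 _] c'z _ _ _]]]]] := prejoin_rays lim1 lim2 (repr z).
by exists c'; rewrite c'z -zc.
Qed.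

Lemma induces_boundary_limit (W : metricType R) (w0 : W) (f : homeo W W)
    (df : homeo (cone_boundary w0) (cone_boundary w0)) :
  induces_on_boundary f df ->
  (forall xi, boundary_limit w0 f xi (df xi)) /\
  (forall xi, boundary_limit w0 (homeo_inv f) xi (homeo_inv df xi)).
Proof.
move=> [F [fF Fxi]]; split=> xi; first exact: extension_boundary_limit fF (Fxi xi).
apply: (extension_boundary_limit (extension_sym fF)) => /=.
by rewrite -[X in inBd w0 X](homeo_invK df) -Fxi homeoK.
Qed.

Lemma product_extension (f1 : homeo X X) (f2 : homeo Y Y)
    (dh1 : homeo (cone_boundary x0) (cone_boundary x0))
    (dh2 : homeo (cone_boundary y0) (cone_boundary y0)) :
  asym_norm x0 f1 -> asym_norm y0 f2 ->
  induces_on_boundary f1 dh1 -> induces_on_boundary f2 dh2 ->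
  exists G : homeo (bordification z0) (bordification z0),
    extends_by (homeo_l2prod f1 f2) G /\
    forall z : join (cone_boundary x0) (cone_boundary y0),
      G (inBd z0 (join_boundary z)) = inBd z0 (join_boundary (join_homeo dh1 dh2 z)).
Proof.
move=> fa1 fa2 /induces_boundary_limit[lim1 lim1'] /induces_boundary_limit[lim2 lim2'].
have fa1' := asym_norm_inv (homeo_invK f1) fa1.
have fa2' := asym_norm_inv (homeo_invK f2) fa2.
have /choice[jinv jP] := join_boundary_surj x0 y0.
have jK z : jinv (join_boundary z) = z by apply: (@join_boundary_inj _ _ _ x0 y0).
pose J := @join_homeo R _ _ _ _ dh1 dh2.
pose d (zeta : boundary (l2prod X Y)) := join_boundary (J (jinv zeta)).
pose d' (zeta : boundary (l2prod X Y)) := join_boundary (homeo_inv J (jinv zeta)).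
have dK : cancel d d' by move=> zeta; rewrite /d /d' jK homeoK jP.
have d'K : cancel d' d by move=> zeta; rewrite /d /d' jK homeo_invK jP.
have lim zeta : boundary_limit z0 (homeo_l2prod f1 f2) zeta (d zeta).
  have -> : d zeta =
      prejoin_boundary x0 y0 (prejoin_map dh1 dh2 (repr (jinv zeta))).
    exact: join_boundaryE.
  by rewrite -{1}[zeta]jP; exact: prejoin_boundary_limit.
have lim' zeta : boundary_limit z0 (homeo_inv (homeo_l2prod f1 f2)) zeta (d' zeta).
  have -> : d' zeta = prejoin_boundary x0 y0
      (prejoin_map (homeo_inv dh1) (homeo_inv dh2) (repr (jinv zeta))).
    exact: join_boundaryE.
  by rewrite -{1}[zeta]jP; exact: prejoin_boundary_limit.
have [G [gG Gd]] := bordification_homeo gXY cXY ray_from_l2 dK d'K lim lim'.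
by exists G; split=> // z; rewrite Gd /d jK.
Qed.

End JoinExtension.

(** * Linearly controlled homeomorphisms of the half-line *)

Section HalfLine.
Context {R : realType}.

Lemma Rpos_continuous : continuous (@Rpos R : R -> Rplus R).
Proof.
apply: continuous_comp_initial => x.
exact: (@continuous_max _ R id (fun=> 0) x cvg_id (cvg_cst _)).
Qed.

(** Injectivity and continuity make [f] monotonic; were it decreasing, [f 0] would
    bound it, against surjectivity. *)
Lemma Rplus_homeo_mono (f : homeo (Rplus R) (Rplus R)) (s t : Rplus R) :
  (rval (f s) < rval (f t)) = (rval s < rval t).
Proof.
pose phi (x : R) : R := rval (f (Rpos x)).
have phiE u : phi (rval u) = rval (f u).
  by rewrite /phi; congr (rval (f _)); apply: rval_inj; rewrite RposE// rval_ge0.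
have cphi : continuous phi.
  move=> x; apply: (@continuous_comp _ _ _ (@Rpos R) (fun u => rval (f u))).
    exact: Rpos_continuous.
  apply: (@continuous_comp _ _ _ f rval); first exact: homeo_continuous.
  exact: initial_continuous.
have mem (u : Rplus R) : rval u \in `[0, +oo[%R by rewrite in_itv /= rval_ge0.
have iphi : {in `[0, +oo[%R &, injective phi}.
  move=> x y; rewrite !in_itv /= !andbT => x0 y0 /rval_inj/(can_inj (homeoK f)).
  by move=> /(congr1 rval); rewrite !RposE.
have wphi : {within [set` `[0, +oo[%R], continuous phi}.
  exact: continuous_subspaceT.
have [up|down] := itv_continuous_inj_mono wphi iphi.
  by rewrite -!phiE (leW_mono_in (le_mono_in up)) ?mem.
have [u fu] : exists u, rval (f Rplus0) < rval (f u).
  have [v v0] := Rplus_large (rval (f Rplus0)).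
  by exists (homeo_inv f v); rewrite homeo_invK.
have u0 : 0 < rval u.
  rewrite lt_neqAle rval_ge0 andbT; apply/eqP => e.
  have e' : u = Rplus0 by apply: rval_inj; rewrite -e.
  by move: fu; rewrite e' ltxx.
have := down _ _ (mem u) (mem Rplus0) u0.
by rewrite !phiE => /(lt_trans fu); rewrite ltxx.
Qed.

Lemma Rplus_homeo_le (f : homeo (Rplus R) (Rplus R)) (s t : Rplus R) :
  (rval (f s) <= rval (f t)) = (rval s <= rval t).
Proof. by rewrite !leNgt Rplus_homeo_mono. Qed.

Lemma linear_control_bounds (f : homeo (Rplus R) (Rplus R)) (a : Rplus R) (e : R) :
  linearly_controlled f -> 0 < rval a -> 0 < e -> exists M : R, forall s,
    M < rval (f s) -> `|rval (f (Rplus_mul a s)) - rval (f s)| <= e * rval (f s).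
Proof.
move=> lf a0 e0.
have /cvgrPdist_lt/(_ e e0)[M _ HM] := lf a a0.
exists (Num.max M 0) => s; rewrite gt_max => /andP[Ms s0].
have /= := HM _ Ms; rewrite homeoK distrC => h.
have -> : rval (f (Rplus_mul a s)) - rval (f s) =
    (rval (f (Rplus_mul a s)) / rval (f s) - 1) * rval (f s).
  by rewrite mulrBl divfK ?gt_eqF// mul1r.
by rewrite normrM (gtr0_norm s0) ler_wpM2r// ltW.
Qed.

End HalfLine.

(** * Radial homeomorphisms *)

Section Radial.
Context {R : realType} {L : topologicalType} {Y : metricType R} (y0 : Y).
Variable Theta : homeo (open_cone (R := R) L) Y.
Hypotheses (pY : proper_space Y) (gY : geodesic_space Y) (cY : cosine_law Y)
  (cone : radial_cone_structure y0 Theta).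

Let rY (c : ray Y) := asymptotic_ray_from y0 c pY cY gY.

Lemma polar_coordinates (y : Y) : exists l, y = Theta (cone_pt l (rdist y0 y)).
Proof.
have -> : y = Theta (cone_pt (repr (homeo_inv Theta y)).1 (repr (homeo_inv Theta y)).2).
  by rewrite /cone_pt -surjective_pairing reprK homeo_invK.
move: (repr _) => [l t] /=; exists l; congr (Theta (cone_pt l _)).
have [_ /(_ l)[Ty0 Tray]] := cone; apply: rval_inj.
by rewrite rvalE -Ty0 Tray rvalE sub0r normrN ger0_norm// rval_ge0.
Qed.

Lemma dist_cone_pt l (t : Rplus R) : mdist y0 (Theta (cone_pt l t)) = rval t.
Proof.
have [_ /(_ l)[Ty0 Tray]] := cone.
by rewrite -Ty0 Tray rvalE sub0r normrN ger0_norm// rval_ge0.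
Qed.

Lemma at_dist_cone_pt l (s t : Rplus R) : rval s <= rval t ->
  at_dist (rval s) y0 (Theta (cone_pt l t)) (Theta (cone_pt l s)).
Proof.
move=> st; have [_ /(_ l)[Ty0 Tray]] := cone.
have := ray_at_dist (Ray Tray) st; rewrite /= Ty0; exact.
Qed.

Lemma radial_homeo_sym (hhat : homeo (Rplus R) (Rplus R)) (f : homeo Y Y) :
  radial_homeo Theta hhat f -> radial_homeo Theta (homeo_sym hhat) (homeo_sym f).
Proof.
by move=> rf l t /=; apply: (can_inj (homeoK f)); rewrite homeo_invK rf homeo_invK.
Qed.

Lemma radial_norm (hhat : homeo (Rplus R) (Rplus R)) (f : homeo Y Y) (y : Y) :
  radial_homeo Theta hhat f -> rdist y0 (f y) = hhat (rdist y0 y).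
Proof.
move=> rf; have [l yl] := polar_coordinates y; apply: rval_inj.
by rewrite rvalE {1}yl rf dist_cone_pt.
Qed.

(** A radial homeomorphism moves points along the geodesics from [y0], and the
    cone topology at infinity only sees these geodesics: it extends by the
    identity of the boundary. *)
Lemma radial_boundary_limit (hhat : homeo (Rplus R) (Rplus R)) (f : homeo Y Y) xi :
  radial_homeo Theta hhat f -> boundary_limit y0 f xi xi.
Proof.
move=> rf F FF; have [c [c0 <-]] := boundary_ray rY xi.
move=> /(cvg_inBdP gY cY c0) Fc.
apply/(cvg_inBdP gY cY (F := f @ F) c0) => r e r0 e0.
pose T := Rpos (rval (homeo_inv hhat r) + 1).
have TE : rval T = rval (homeo_inv hhat r) + 1.
  by rewrite RposE// addr_ge0// rval_ge0.
have T0 : 0 < rval T by rewrite TE ltr_pwDr// rval_ge0.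
have := @filterI _ F FF _ _ (Fc r e r0 e0) (Fc T _ T0 ltr01).
apply: (@filterS _ F) => w [] /= /(cone_nbhdP _ gY)[rw [u [ru ue]]].
move=> /(cone_nbhdP _ gY)[Tw _].
have [l wl] := polar_coordinates w.
have rh : rval r < rval (hhat (rdist y0 w)).
  rewrite -(homeo_invK hhat r) Rplus_homeo_mono rvalE.
  by apply: lt_trans Tw; rewrite TE ltrDl.
apply/(cone_nbhdP _ gY); rewrite wl rf dist_cone_pt; split=> //.
exists u; split=> //; suff -> : u = Theta (cone_pt l r).
  exact: at_dist_cone_pt (ltW rh).
apply: (at_dist_uniq cY (rval_ge0 r) (ltW rw) ru).
by rewrite wl; apply: at_dist_cone_pt; rewrite -[rdist _ _]/(rdist y0 w) rvalE ltW.
Qed.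

Lemma radial_extends (hhat : homeo (Rplus R) (Rplus R)) (f : homeo Y Y) :
  radial_homeo Theta hhat f ->
  exists F : homeo (bordification y0) (bordification y0),
    extends_by f F /\ forall xi, F (inBd y0 xi) = inBd y0 xi.
Proof.
move=> rf; apply: (bordification_homeo gY cY rY (d := id) (d' := id)) => // xi.
  exact: radial_boundary_limit rf.
exact: radial_boundary_limit (radial_homeo_sym rf).
Qed.

(** A quasi-isometry changes the distance [s] to [y0] to some [s'] between
    [s / (2 * K)] and [2 * K * s], for [s] large. After conjugation the distances
    become [hhat s] and [hhat s'], and monotonicity of [hhat] with linear control
    at the two slopes [(2 * K)^-1] and [2 * K] makes their ratio tend to [1]. *)
Lemma conjugate_asym_norm (hhat : homeo (Rplus R) (Rplus R)) (hr h2 : homeo Y Y) :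
  radial_homeo Theta hhat hr -> linearly_controlled hhat -> quasi_isometry h2 ->
  asym_norm y0 (homeo_comp hr (homeo_comp h2 (homeo_sym hr))).
Proof.
move=> rf lc [K [C [K1 C0 qi _]]] e e0.
pose C' := C + mdist y0 (h2 y0).
have b0 := mdist_ge0 y0 (h2 y0).
have C'0 : 0 <= C' by rewrite addr_ge0.
have K0 : 0 < K by lra.
pose a1 := Rpos (2 * K); pose a2 := Rpos (2 * K)^-1.
have a1E : rval a1 = 2 * K by rewrite RposE//; lra.
have K2 : 0 < (2 * K)^-1 by rewrite invr_gt0; lra.
have a2E : rval a2 = (2 * K)^-1 by rewrite RposE// ltW.
have [|M1 HM1] := linear_control_bounds (a := a1) lc _ e0; first by rewrite a1E; lra.
have [|M2 HM2] := linear_control_bounds (a := a2) lc _ e0; first by rewrite a2E.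
(* From [S0] on, the additive constant is absorbed by doubling [K]. *)
pose S0 := Rpos (2 * K * C').
have S0E : rval S0 = 2 * K * C' by rewrite RposE// mulr_ge0//; lra.
(* Up to [hhat s <= T1] both distances are bounded, and they go into the additive
   constant. *)
pose T1 := Rpos (`|M1| + `|M2| + rval (hhat S0)).
have T1E : rval T1 = `|M1| + `|M2| + rval (hhat S0).
  by rewrite RposE// !addr_ge0// rval_ge0.
pose S2 := Rpos (K * rval (homeo_inv hhat T1) + C').
have S2E : rval S2 = K * rval (homeo_inv hhat T1) + C'.
  by rewrite RposE// addr_ge0// mulr_ge0 ?rval_ge0// ltW.
exists (rval T1 + rval (hhat S2)) => y /=.
set x := homeo_inv hr y; pose s := rdist y0 x; pose s' := rdist y0 (h2 x).
have tE : mdist y0 y = rval (hhat s).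
  by rewrite -(radial_norm x rf) rvalE /x homeo_invK.
have t'E : mdist y0 (hr (h2 x)) = rval (hhat s') by rewrite -(radial_norm (h2 x) rf).
rewrite tE t'E.
have s'up : rval s' <= K * rval s + C'.
  have /andP[_ up] := qi y0 x.
  by have := metric_triangle y0 (h2 y0) (h2 x); rewrite !rvalE /C'; lra.
have s'lo : rval s / K - C' <= rval s'.
  have /andP[lo _] := qi y0 x.
  have := metric_triangle (h2 y0) y0 (h2 x); rewrite !rvalE /C' (metric_sym _ y0); lra.
have ht0 := rval_ge0 (hhat s); have ht'0 := rval_ge0 (hhat s').
have := ler_norm M1; have := ler_norm M2 => nM2 nM1.
have nM10 := normr_ge0 M1; have nM20 := normr_ge0 M2.
have [small|big] := leP (rval (hhat s)) (rval T1).
  have sT : rval s <= rval (homeo_inv hhat T1).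
    by rewrite -(Rplus_homeo_le hhat) homeo_invK.
  have hS2 : rval (hhat s') <= rval (hhat S2).
    rewrite Rplus_homeo_le S2E; apply: le_trans s'up _.
    by rewrite lerD2r ler_wpM2l// ltW.
  have := mulr_ge0 (ltW e0) ht0; have := rval_ge0 T1.
  rewrite ler_norml; lra.
have hS0 := rval_ge0 (hhat S0).
have sS0 : rval S0 < rval s.
  by rewrite -(Rplus_homeo_mono hhat); move: big; rewrite T1E; lra.
rewrite S0E in sS0.
have up : rval (hhat s') <= rval (hhat (Rplus_mul a1 s)).
  rewrite Rplus_homeo_le rvalM a1E; apply: le_trans s'up _.
  have : C' <= K * (2 * K * C').
    have : C' <= 2 * K * K * C'.
      by rewrite -[leLHS]mul1r ler_wpM2r//; nra.
    lra.
  have := ler_wpM2l (ltW K0) (ltW sS0); lra.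
have lo : rval (hhat (Rplus_mul a2 s)) <= rval (hhat s').
  rewrite Rplus_homeo_le rvalM a2E; apply: le_trans s'lo.
  have -> : rval s / K = (2 * K)^-1 * rval s + (2 * K)^-1 * rval s.
    by field; rewrite gt_eqF.
  have : C' <= (2 * K)^-1 * rval s.
    by rewrite mulrC ler_pdivlMr; [rewrite mulrC; exact: ltW|lra].
  lra.
have := HM1 s; have := HM2 s; rewrite T1E in big.
have -> : M1 < rval (hhat s) by lra.
have -> : M2 < rval (hhat s) by lra.
move=> /(_ isT) + /(_ isT); rewrite !ler_norml => /andP[l1 l2] /andP[u1 u2].
have := rval_ge0 T1; have := rval_ge0 (hhat S2); lra.
Qed.

End Radial.

(** * The compressed homeomorphism *)

Unset Implicit Arguments.

Theorem theorem5p3 (R : realType) (X Y : metricType R) (x0 : X) (y0 : Y)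
    (h : homeo (l2prod X Y) (l2prod X Y)) (h1 : X -> X) (h2 : homeo Y Y)
    (L : topologicalType) (Theta : homeo (open_cone (R := R) L) Y)
    (psi : Rplus R -> Rplus R) (hpsi : homeo Y Y)
    (hhat : homeo (Rplus R) (Rplus R)) :
  proper_space X -> CAT0 X -> proper_space Y -> CAT0 Y ->
  (forall x y, h (x, y) = (h1 x, h2 y)) ->
  metric_isometry h1 ->
  quasi_isometry h2 -> extends_to_boundary y0 h2 ->
  radial_cone_structure y0 Theta ->
  proper_function psi ->
  compressing psi hpsi ->
  radial_homeo Theta hhat hpsi ->
  linearly_controlled hhat ->
  let Hpsi := homeo_l2prod (homeo_id : homeo X X) hpsi in
  let g := homeo_comp Hpsi (homeo_comp h (homeo_sym Hpsi)) in
  exists (G : homeo (bordification ((x0, y0) : l2prod X Y))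
                    (bordification ((x0, y0) : l2prod X Y)))
         (dh1 : homeo (cone_boundary x0) (cone_boundary x0))
         (dh2 : homeo (cone_boundary y0) (cone_boundary y0)),
    [/\ extends_by g G,
        induces_on_boundary h1 dh1,
        induces_on_boundary h2 dh2 &
        forall z : join (cone_boundary x0) (cone_boundary y0),
          G (inBd _ (join_boundary z)) =
          inBd _ (join_boundary (join_homeo dh1 dh2 z))].
Proof.
move=> pX catX pY catY hE iso qi [F2 hF2] cone _ _ rad lc Hpsi g.
have gX := catX.1; have gY := catY.1.
have cX := CAT0_cosine_law catX; have cY := CAT0_cosine_law catY.
have [f1 f1E] := factor_isometry_homeo y0 hE iso.
have iso1 : metric_isometry f1 by move=> x y; rewrite !f1E.
have [F1 hF1] := isometry_extends x0 pX gX cX iso1.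
have [dh1 dh1E] := extension_boundary_homeo hF1.
have [dh2 dh2E] := extension_boundary_homeo hF2.
have [P [hP PE]] := radial_extends pY gY cY cone rad.
pose f2 := homeo_comp hpsi (homeo_comp h2 (homeo_sym hpsi)).
have ind1 : induces_on_boundary f1 dh1 by exists F1.
have ind2 : induces_on_boundary f2 dh2.
  exists (homeo_comp P (homeo_comp F2 (homeo_sym P))); split=> [|xi].
    exact: (extends_by_comp hP (extends_by_comp hF2 (extension_sym hP))).
  have P'E : homeo_inv P (inBd y0 xi) = inBd y0 xi by rewrite -{1}PE homeoK.
  by rewrite /= P'E dh2E PE.
have na1 := isometry_asym_norm x0 iso1.
have na2 := conjugate_asym_norm cone rad lc qi.
have [G [hG GE]] := product_extension pX gX cX pY gY cY na1 na2 ind1 ind2.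
exists G, dh1, dh2; split=> //.
- by move=> [x y]; rewrite hG /= f1E hE.
- by exists F1; split=> // x; rewrite hF1 f1E.
- by exists F2.
Qed.
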